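(* Let $\mathcal K$ be a 2-category and $n\ge0$ an integer. The 2-functor $E:\mathsf{Wdl}^{(n)}(\overline{\mathcal K})\to\mathsf{Mnd}(\overline{\mathcal K})^{\mathbf 2^{n+1}}$ described in the context is fully faithful (it is injective on 1-cells and on 2-cells, every 1-cell of $\mathsf{Mnd}(\overline{\mathcal K})^{\mathbf 2^{n+1}}$ between images of two 0-cells is the image of a 1-cell, and every 2-cell between images of two 1-cells is the image of a 2-cell).
   Context: Conventions. For 1-cells, $uw$ is the horizontal composite ($w$ first); for 2-cells $\alpha,\beta$, $\alpha\beta$ is their horizontal composite; a 1-cell next to a 2-cell means whiskering; $\alpha.\beta$ is vertical composition ($\beta$ first). A monad $(A,t)$ has multiplication $\mu:tt\to t$, unit $\eta:1_A\to t$; decorations of $t$ carry over to $\mu,\eta$. Local idempotent closure $\overline{\mathcal K}$: same 0-cells as $\mathcal K$; 1-cells $A\to B$ are pairs $(v,\bar v)$ with $v$ a 1-cell of $\mathcal K$ and $\bar v:v\to v$ an idempotent 2-cell; 2-cells $(v,\bar v)\to(v',\bar v')$ are 2-cells $\omega:v\to v'$ of $\mathcal K$ with $\bar v'.\omega=\omega=\omega.\bar v$; compositions induced from $\mathcal K$ (horizontal composite $(uw,\bar u\bar w)$), identity 2-cell of $(v,\bar v)$ is $\bar v$. A monad $(A,(t,\bar t))$ in $\overline{\mathcal K}$ satisfies in particular $\mu.t\eta=\mu.\eta t=\bar t$; we often write just $t$, and $v$ for $(v,\bar v)$. For $\mathcal L\in\{\mathcal K,\overline{\mathcal K}\}$,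 $\mathsf{Mnd}(\mathcal L)$: 0-cells monads in $\mathcal L$; 1-cells $(A,t)\to(A',t')$ are $(v,\psi)$, $\psi:t'v\to vt$, with $\psi.\mu'v=v\mu.\psi t.t'\psi$, $\psi.\eta'v=v\eta$; 2-cells $(v,\psi)\to(v',\psi')$ are $\omega:v\to v'$ with $\psi'.t'\omega=\omega t.\psi$; the composite of $(u,\chi)$ followed by $(v,\psi)$ is $(vu,v\chi.\psi u)$. Weak distributive law in $\mathcal L$: monads $(A,t),(A,s)$ and $\lambda:ts\to st$ with $\lambda.\mu s=s\mu.\lambda t.t\lambda$, $\lambda.t\mu=\mu t.s\lambda.\lambda s$, $\lambda.\eta s=\mu t.s\lambda.st\eta.s\eta$, $\lambda.t\eta=s\mu.\lambda t.\eta st.\eta t$; its idempotent is $\bar\lambda:=\mu t.s\lambda.st\eta$. $\mathsf{Wdl}(\mathcal L)$: 1-cells $\lambda\to\lambda'$ are $(v,\xi,\zeta)$ with $(v,\xi):(A,t)\to(A',t')$, $(v,\zeta):(A,s)\to(A',s')$ in $\mathsf{Mnd}(\mathcal L)$ and $v\lambda.\xi s.t'\zeta=v\bar\lambda.\zeta t.s'\xi.\lambda'v$. $\mathsf{Wdl}^{(n)}(\mathcal L)$: 0-cells are monads $(A,s_0),\dots,(A,s_n)$ in $\mathcal L$ with weak distributive laws $\lambda_{i,j}:s_js_i\to s_is_j$ ($i<j$) satisfying $\lambda_{i,j}s_k.s_j\lambda_{i,k}.\lambda_{j,k}s_i=s_i\lambda_{j,k}.\lambda_{i,k}s_j.s_k\lambda_{i,j}$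 ($i<j<k$); 1-cells are $v:A\to A'$ with $\xi_i:s'_iv\to vs_i$ such that each $(v,\xi_i)$ is in $\mathsf{Mnd}(\mathcal L)$ and $(v,\xi_i,\xi_j)$ is a 1-cell of $\mathsf{Wdl}(\mathcal L)$ for $i<j$; 2-cells are $\omega:v\to v'$ which are 2-cells $(v,\xi_i)\to(v',\xi'_i)$ in $\mathsf{Mnd}(\mathcal L)$ for all $i$. Iterated products. Fix a 0-cell $\{\lambda_{i,j}\}$ of $\mathsf{Wdl}^{(n)}(\overline{\mathcal K})$. For $i_0<\dots<i_m$ write $s_I=s_{i_0}\cdots s_{i_m}$; a ''reordering composite'' is any composite of whiskered $\lambda_{i,j}$'s of minimal length between given products (all such agree by Yang–Baxter). Define $\bar\lambda_I$: $\bar s_{i_0}$ if $m=0$; $\bar\lambda_{i_0i_1}$ if $m=1$; for $m\ge2$, $\bar\lambda_I=\overleftarrow\lambda_I.(\bar\lambda_{i_0\dots i_{m-1}}s_{i_m})$ where $\overleftarrow\lambda_I=s_{i_0}\cdots s_{i_{m-1}}\mu_{i_m}.R.\eta_{i_m}s_I$ and $R:s_{i_m}s_I\to s_Is_{i_m}$ is the reordering composite. The monad $(s_I,\bar\lambda_I)$ in $\overline{\mathcal K}$ has multiplication $\bar\lambda_I.\mu_{i_0}\cdots\mu_{i_m}.R_1$ with $R_1:s_Is_I\to s_{i_0}s_{i_0}\cdots s_{i_m}s_{i_m}$ reordering, and unit $\bar\lambda_I.R_2.\eta_{i_m}\cdots\eta_{i_0}$ with $R_2:s_{i_m}\cdots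 s_{i_0}\to s_I$ reordering; for $I=\emptyset$ it is the trivial monad $(1_A,1_{1_A})$. For a 1-cell $(v,\{\xi_i\})$ put $\xi_I=v\bar\lambda_I.\xi_{i_0}s_{i_1}\cdots s_{i_m}.\cdots.s'_{i_0}\cdots s'_{i_{m-1}}\xi_{i_m}:s'_Iv\to vs_I$, and $\xi_\emptyset=\bar v$. Cubes. Elements $\underline p\in\{0,1\}^{n+1}$ correspond to subsets $I_{\underline p}=\{i:p_i=1\}$; write $s_{\underline p},\bar\lambda_{\underline p},\xi_{\underline p}$ accordingly; $\underline p+i$ means setting $p_i$ from $0$ to $1$. For a 2-category $\mathcal M$, $\mathcal M^{\mathbf 2^{n+1}}$ has as 0-cells families of 0-cells $X_{\underline p}$ with 1-cells $f_{\underline p,i}:X_{\underline p+i}\to X_{\underline p}$ (whenever $p_i=0$) such that $f_{\underline p,i}f_{\underline p+i,j}=f_{\underline p,j}f_{\underline p+j,i}$; 1-cells are families $u_{\underline p}:X_{\underline p}\to X'_{\underline p}$ with $f'_{\underline p,i}u_{\underline p+i}=u_{\underline p}f_{\underline p,i}$; 2-cells are families $\omega_{\underline p}:u_{\underline p}\to\tilde u_{\underline p}$ with $f'_{\underline p,i}\omega_{\underline p+i}=\omega_{\underline p}f_{\underline p,i}$. The 2-functor $E$: a 0-cell goes to the cube with vertices $(A,(s_{\underline p},\bar\lambda_{\underline p}))$ and edges $((A,1_{1_A}),\varphi^i_{\underline p}):(A,s_{\underline p+i})\to(A,s_{\underline p})$, where $\varphi^i_{\underline p}=\bar\lambda_{\underline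 p+i}.(s_{I'}\eta_is_{I''}):s_{\underline p}\to s_{\underline p+i}$ with $I',I''$ the elements of $I_{\underline p}$ smaller, resp. larger, than $i$; a 1-cell $(v,\{\xi_i\})$ goes to the family $((v,\bar v),\xi_{\underline p})$; a 2-cell $\omega$ goes to the family constantly $\omega$. *)

(* Defs.v *)
From mathcomp Require Import all_boot.

Set Implicit Arguments.
Unset Strict Implicit.
Unset Printing Implicit Defensive.

(* Strict 2-categories, presented with, for each pair of 0-cells a b,  *)
(* a type [Hom a b] of 1-cells and a type [Cell a b] of all 2-cells    *)
(* between 1-cells a -> b (the disjoint union of the hom-sets), each   *)
(* 2-cell carrying its source and target 1-cell.  Vertical composition *)
(* is a total operation whose value is only meaningful (and only       *)
(* constrained) on composable pairs.                                   *)
(*   comp u w   = uw   (w first)                                       *)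
(*   vcomp a b  = a.b  (b first)                                       *)
(*   hcomp a b  = ab   (horizontal composite)                          *)
Record TwoCat := {
  Ob : Type;
  Hom : Ob -> Ob -> Type;
  Cell : Ob -> Ob -> Type;
  idh : forall a, Hom a a;
  comp : forall a b c, Hom b c -> Hom a b -> Hom a c;
  src : forall a b, Cell a b -> Hom a b;
  tgt : forall a b, Cell a b -> Hom a b;
  id2 : forall a b, Hom a b -> Cell a b;
  vcomp : forall a b, Cell a b -> Cell a b -> Cell a b;
  hcomp : forall a b c, Cell b c -> Cell a b -> Cell a c;
  comp_assoc : forall a b c d (u : Hom c d) (v : Hom b c) (w : Hom a b),
      comp (comp u v) w = comp u (comp v w);
  comp_id_l : forall a b (u : Hom a b), comp (idh b) u = u;
  comp_id_r : forall a b (u : Hom a b), comp u (idh a) = u;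
  src_id2 : forall a b (u : Hom a b), src (id2 u) = u;
  tgt_id2 : forall a b (u : Hom a b), tgt (id2 u) = u;
  src_vcomp : forall a b (x y : Cell a b), tgt y = src x -> src (vcomp x y) = src y;
  tgt_vcomp : forall a b (x y : Cell a b), tgt y = src x -> tgt (vcomp x y) = tgt x;
  src_hcomp : forall a b c (x : Cell b c) (y : Cell a b),
      src (hcomp x y) = comp (src x) (src y);
  tgt_hcomp : forall a b c (x : Cell b c) (y : Cell a b),
      tgt (hcomp x y) = comp (tgt x) (tgt y);
  vcomp_assoc : forall a b (x y z : Cell a b), tgt z = src y -> tgt y = src x ->
      vcomp (vcomp x y) z = vcomp x (vcomp y z);
  vcomp_id_l : forall a b (x : Cell a b), vcomp (id2 (tgt x)) x = x;
  vcomp_id_r : forall a b (x : Cell a b), vcomp x (id2 (src x)) = x;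
  hcomp_assoc : forall a b c d (x : Cell c d) (y : Cell b c) (z : Cell a b),
      hcomp (hcomp x y) z = hcomp x (hcomp y z);
  hcomp_id_l : forall a b (x : Cell a b), hcomp (id2 (idh b)) x = x;
  hcomp_id_r : forall a b (x : Cell a b), hcomp x (id2 (idh a)) = x;
  hcomp_id2 : forall a b c (u : Hom b c) (v : Hom a b),
      hcomp (id2 u) (id2 v) = id2 (comp u v);
  interchange : forall a b c (x y : Cell b c) (z w : Cell a b),
      tgt y = src x -> tgt w = src z ->
      hcomp (vcomp x y) (vcomp z w) = vcomp (hcomp x z) (hcomp y w)
}.

Arguments Hom : clear implicits.
Arguments Cell : clear implicits.
Arguments idh {_} a.
Arguments comp {_ a b c}.
Arguments src {_ a b}.
Arguments tgt {_ a b}.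
Arguments id2 {_ a b}.
Arguments vcomp {_ a b}.
Arguments hcomp {_ a b c}.

(* The local idempotent closure  \overline{K}, used inline:            *)
(* a 1-cell is a pair (v, vbar); a 2-cell (v,vbar) -> (v',vbar') is a  *)
(* 2-cell w : v -> v' of K with vbar'.w = w = w.vbar.                  *)
Record bar1 (K : TwoCat) (A B : Ob K) := Bar1 { b1 : Hom K A B; bb : Cell K A B }.
Arguments bar1 : clear implicits.
Arguments Bar1 {K A B}.
Arguments b1 {K A B}.
Arguments bb {K A B}.

Definition wf1 (K : TwoCat) (A B : Ob K) (x : bar1 K A B) : Prop :=
  src (bb x) = b1 x /\ tgt (bb x) = b1 x /\ vcomp (bb x) (bb x) = bb x.

Definition is2 (K : TwoCat) (A B : Ob K) (w : Cell K A B) (x y : bar1 K A B) : Prop :=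
  src w = b1 x /\ tgt w = b1 y /\ vcomp (bb y) w = w /\ vcomp w (bb x) = w.

Definition barid (K : TwoCat) (A : Ob K) : bar1 K A A := Bar1 (idh A) (id2 (idh A)).
Definition barcomp (K : TwoCat) (A B C : Ob K) (x : bar1 K B C) (y : bar1 K A B)
  : bar1 K A C := Bar1 (comp (b1 x) (b1 y)) (hcomp (bb x) (bb y)).

Record Mon (K : TwoCat) (A : Ob K) := MkMon { mt : bar1 K A A; mmu : Cell K A A; meta : Cell K A A }.
Arguments Mon : clear implicits.
Arguments MkMon {K A}.
Arguments mt {K A}.
Arguments mmu {K A}.
Arguments meta {K A}.

Definition is_monad (K : TwoCat) (A : Ob K) (m : Mon K A) : Prop :=
  let t := mt m in let mu := mmu m in let eta := meta m in
  [/\ wf1 t, is2 mu (barcomp t t) t, is2 eta (barid A) t,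
      vcomp mu (hcomp mu (bb t)) = vcomp mu (hcomp (bb t) mu) &
      vcomp mu (hcomp (bb t) eta) = bb t /\
      vcomp mu (hcomp eta (bb t)) = bb t].

Definition is_mnd1 (K : TwoCat) (A A' : Ob K) (m : Mon K A) (m' : Mon K A')
    (v : bar1 K A A') (psi : Cell K A A') : Prop :=
  [/\ wf1 v, is2 psi (barcomp (mt m') v) (barcomp v (mt m)),
      vcomp psi (hcomp (mmu m') (bb v))
        = vcomp (hcomp (bb v) (mmu m))
            (vcomp (hcomp psi (bb (mt m))) (hcomp (bb (mt m')) psi)) &
      vcomp psi (hcomp (meta m') (bb v)) = hcomp (bb v) (meta m)].

Definition is_mnd2 (K : TwoCat) (A A' : Ob K) (m : Mon K A) (m' : Mon K A')
    (v : bar1 K A A') (psi : Cell K A A') (v' : bar1 K A A') (psi' : Cell K A A')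
    (w : Cell K A A') : Prop :=
  is2 w v v' /\
  vcomp psi' (hcomp (bb (mt m')) w) = vcomp (hcomp w (bb (mt m))) psi.

Definition mcomp (K : TwoCat) (A B C : Ob K)
    (f : bar1 K B C * Cell K B C) (g : bar1 K A B * Cell K A B)
    : bar1 K A C * Cell K A C :=
  (barcomp f.1 g.1, vcomp (hcomp (bb f.1) g.2) (hcomp f.2 (bb g.1))).

Definition wdl_bar (K : TwoCat) (A : Ob K) (t s : Mon K A) (lam : Cell K A A) : Cell K A A :=
  vcomp (hcomp (mmu s) (bb (mt t)))
    (vcomp (hcomp (bb (mt s)) lam) (hcomp (hcomp (bb (mt s)) (bb (mt t))) (meta s))).

Definition is_wdl (K : TwoCat) (A : Ob K) (t s : Mon K A) (lam : Cell K A A) : Prop :=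
  let tb := bb (mt t) in let sb := bb (mt s) in
  [/\ is2 lam (barcomp (mt t) (mt s)) (barcomp (mt s) (mt t)),
      vcomp lam (hcomp (mmu t) sb)
        = vcomp (hcomp sb (mmu t)) (vcomp (hcomp lam tb) (hcomp tb lam)),
      vcomp lam (hcomp tb (mmu s))
        = vcomp (hcomp (mmu s) tb) (vcomp (hcomp sb lam) (hcomp lam sb)),
      vcomp lam (hcomp (meta t) sb)
        = vcomp (hcomp (mmu s) tb) (vcomp (hcomp sb lam)
            (vcomp (hcomp (hcomp sb tb) (meta s)) (hcomp sb (meta t)))) &
      vcomp lam (hcomp tb (meta s))
        = vcomp (hcomp sb (mmu t)) (vcomp (hcomp lam tb)
            (vcomp (hcomp (meta t) (hcomp sb tb)) (hcomp (meta s) tb)))].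

Definition is_wdl1 (K : TwoCat) (A A' : Ob K) (t s : Mon K A) (t' s' : Mon K A')
    (lam : Cell K A A) (lam' : Cell K A' A') (v : bar1 K A A') (xi zeta : Cell K A A') : Prop :=
  vcomp (hcomp (bb v) lam) (vcomp (hcomp xi (bb (mt s))) (hcomp (bb (mt t')) zeta))
  = vcomp (hcomp (bb v) (wdl_bar t s lam))
      (vcomp (hcomp zeta (bb (mt t))) (vcomp (hcomp (bb (mt s')) xi) (hcomp lam' (bb v)))).

(* 0-cells: a 0-cell A, monads s_0..s_n on A, and lam i j : s_j s_i -> s_i s_j
   (only used for i < j). *)
Record WObj (K : TwoCat) (n : nat) := MkWObj {
  wA : Ob K;
  wm : 'I_n.+1 -> Mon K wA;
  wl : 'I_n.+1 -> 'I_n.+1 -> Cell K wA wA }.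
Arguments wA {K n}.
Arguments wm {K n}.
Arguments wl {K n}.

Definition wobj_wf (K : TwoCat) (n : nat) (X : WObj K n) : Prop :=
  [/\ forall i, is_monad (wm X i),
      forall i j : 'I_n.+1, (i < j)%N -> is_wdl (wm X j) (wm X i) (wl X i j) &
      forall i j k : 'I_n.+1, (i < j)%N -> (j < k)%N ->
        let sb l := bb (mt (wm X l)) in
        vcomp (hcomp (wl X i j) (sb k))
          (vcomp (hcomp (sb j) (wl X i k)) (hcomp (wl X j k) (sb i)))
        = vcomp (hcomp (sb i) (wl X j k))
          (vcomp (hcomp (wl X i k) (sb j)) (hcomp (sb k) (wl X i j)))].

Record WHom (K : TwoCat) (n : nat) (X Y : WObj K n) := MkWHom {
  hv : bar1 K (wA X) (wA Y);
  hxi : {ffun 'I_n.+1 -> Cell K (wA X) (wA Y)} }.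
Arguments MkWHom {K n X Y}.
Arguments hv {K n X Y}.
Arguments hxi {K n X Y}.

Definition whom_wf (K : TwoCat) (n : nat) (X Y : WObj K n) (F : WHom X Y) : Prop :=
  (forall i, is_mnd1 (wm X i) (wm Y i) (hv F) (hxi F i)) /\
  (forall i j : 'I_n.+1, (i < j)%N ->
     is_wdl1 (wm X j) (wm X i) (wm Y j) (wm Y i) (wl X i j) (wl Y i j)
             (hv F) (hxi F j) (hxi F i)).

Definition w2_wf (K : TwoCat) (n : nat) (X Y : WObj K n) (F G : WHom X Y)
    (w : Cell K (wA X) (wA Y)) : Prop :=
  forall i, is_mnd2 (wm X i) (wm Y i) (hv F) (hxi F i) (hv G) (hxi G i) w.

Definition sw (K : TwoCat) (A : Ob K) (n : nat) (s : 'I_n.+1 -> Mon K A)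
    (w : seq 'I_n.+1) : Hom K A A :=
  foldr (fun i acc => comp (b1 (mt (s i))) acc) (idh A) w.

(* its decoration as a composite in \overline{K} (= its identity 2-cell) *)
Definition sbw (K : TwoCat) (A : Ob K) (n : nat) (s : 'I_n.+1 -> Mon K A)
    (w : seq 'I_n.+1) : Cell K A A :=
  foldr (fun i acc => hcomp (bb (mt (s i))) acc) (id2 (idh A)) w.

Fixpoint ins (n : nat) (i : 'I_n.+1) (w : seq 'I_n.+1) : seq 'I_n.+1 :=
  match w with
  | [::] => [:: i]
  | j :: w' => if (val j < val i)%N then j :: ins i w' else i :: w
  end.
Definition isort (n : nat) (w : seq 'I_n.+1) : seq 'I_n.+1 := foldr (@ins n) [::] w.

(* reordering composites of whiskered lam's, following insertion sort:
   insc i w : s_i s_w -> s_(ins i w)   (w sorted)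
   sortc w  : s_w -> s_(isort w) *)
Fixpoint insc (K : TwoCat) (A : Ob K) (n : nat) (s : 'I_n.+1 -> Mon K A)
    (lam : 'I_n.+1 -> 'I_n.+1 -> Cell K A A) (i : 'I_n.+1) (w : seq 'I_n.+1)
    : Cell K A A :=
  match w with
  | [::] => sbw s [:: i]
  | j :: w' =>
      if (val j < val i)%N
      then vcomp (hcomp (bb (mt (s j))) (insc s lam i w')) (hcomp (lam j i) (sbw s w'))
      else sbw s (i :: w)
  end.

Fixpoint sortc (K : TwoCat) (A : Ob K) (n : nat) (s : 'I_n.+1 -> Mon K A)
    (lam : 'I_n.+1 -> 'I_n.+1 -> Cell K A A) (w : seq 'I_n.+1) : Cell K A A :=
  match w with
  | [::] => id2 (idh A)
  | i :: w' => vcomp (insc s lam i (isort w')) (hcomp (bb (mt (s i))) (sortc s lam w'))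
  end.

Definition hmu (K : TwoCat) (A : Ob K) (n : nat) (s : 'I_n.+1 -> Mon K A)
    (w : seq 'I_n.+1) : Cell K A A :=
  foldr (fun i acc => hcomp (mmu (s i)) acc) (id2 (idh A)) w.
Definition heta (K : TwoCat) (A : Ob K) (n : nat) (s : 'I_n.+1 -> Mon K A)
    (w : seq 'I_n.+1) : Cell K A A :=
  foldr (fun i acc => hcomp (meta (s i)) acc) (id2 (idh A)) w.

(* arrow lambda_I for I = I' ++ [y]:
   s_{I'} mu_y . R . eta_y s_I,   R : s_y s_I -> s_I s_y reordering *)
Definition arrowl (K : TwoCat) (A : Ob K) (n : nat) (s : 'I_n.+1 -> Mon K A)
    (lam : 'I_n.+1 -> 'I_n.+1 -> Cell K A A) (I' : seq 'I_n.+1) (y : 'I_n.+1)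
    : Cell K A A :=
  vcomp (hcomp (sbw s I') (mmu (s y)))
    (vcomp (sortc s lam (y :: rcons I' y)) (hcomp (meta (s y)) (sbw s (rcons I' y)))).

(* lambdabar on the reversed word *)
Fixpoint lbr (K : TwoCat) (A : Ob K) (n : nat) (s : 'I_n.+1 -> Mon K A)
    (lam : 'I_n.+1 -> 'I_n.+1 -> Cell K A A) (r : seq 'I_n.+1) : Cell K A A :=
  match r with
  | [::] => id2 (idh A)
  | [:: x] => bb (mt (s x))
  | [:: y; x] => wdl_bar (s y) (s x) (lam x y)
  | y :: r' => vcomp (arrowl s lam (rev r') y) (hcomp (lbr s lam r') (bb (mt (s y))))
  end.

(* lambdabar_I for an increasing word I *)
Definition lbar (K : TwoCat) (A : Ob K) (n : nat) (s : 'I_n.+1 -> Mon K A)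
    (lam : 'I_n.+1 -> 'I_n.+1 -> Cell K A A) (I : seq 'I_n.+1) : Cell K A A :=
  lbr s lam (rev I).

Definition prodmon (K : TwoCat) (A : Ob K) (n : nat) (s : 'I_n.+1 -> Mon K A)
    (lam : 'I_n.+1 -> 'I_n.+1 -> Cell K A A) (I : seq 'I_n.+1) : Mon K A :=
  match I with
  | [::] => MkMon (barid A) (id2 (idh A)) (id2 (idh A))
  | _ => MkMon (Bar1 (sw s I) (lbar s lam I))
          (vcomp (lbar s lam I) (vcomp (hmu s I) (sortc s lam (I ++ I))))
          (vcomp (lbar s lam I) (vcomp (sortc s lam (rev I)) (heta s (rev I))))
  end.

(* Vertices of {0,1}^{n+1} are subsets p of 'I_n.+1; I_p = enum p      *)
(* (increasing).                                                       *)
Definition cube_mon (K : TwoCat) (n : nat) (X : WObj K n) (p : {set 'I_n.+1}) : Mon K (wA X) :=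
  prodmon (wm X) (wl X) (enum p).

Definition cube_phi (K : TwoCat) (n : nat) (X : WObj K n) (p : {set 'I_n.+1}) (i : 'I_n.+1)
    : Cell K (wA X) (wA X) :=
  vcomp (lbar (wm X) (wl X) (enum (i |: p)))
    (hcomp (sbw (wm X) [seq j <- enum p | (val j < val i)%N])
       (hcomp (meta (wm X i)) (sbw (wm X) [seq j <- enum p | (val i < val j)%N]))).

(* edge ((A,1_{1_A}), phi^i_p) : (A, s_{p+i}) -> (A, s_p) *)
Definition cube_edge (K : TwoCat) (n : nat) (X : WObj K n) (p : {set 'I_n.+1}) (i : 'I_n.+1)
    : bar1 K (wA X) (wA X) * Cell K (wA X) (wA X) :=
  (barid (wA X), cube_phi X p i).

Fixpoint xc (K : TwoCat) (A A' : Ob K) (n : nat) (s : 'I_n.+1 -> Mon K A)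
    (s' : 'I_n.+1 -> Mon K A') (v : bar1 K A A') (xi : 'I_n.+1 -> Cell K A A')
    (w : seq 'I_n.+1) : Cell K A A' :=
  match w with
  | [::] => bb v
  | [:: i] => xi i
  | i :: w' => vcomp (hcomp (xi i) (sbw s w')) (hcomp (bb (mt (s' i))) (xc s s' v xi w'))
  end.

Definition xiP (K : TwoCat) (n : nat) (X Y : WObj K n) (F : WHom X Y) (p : {set 'I_n.+1})
    : Cell K (wA X) (wA Y) :=
  match enum p with
  | [::] => bb (hv F)
  | w => vcomp (hcomp (bb (hv F)) (lbar (wm X) (wl X) w))
               (xc (wm X) (wm Y) (hv F) (hxi F) w)
  end.

Definition E1 (K : TwoCat) (n : nat) (X Y : WObj K n) (F : WHom X Y)
    : {ffun {set 'I_n.+1} -> bar1 K (wA X) (wA Y) * Cell K (wA X) (wA Y)} :=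
  [ffun p => (hv F, xiP F p)].

Definition E2 (K : TwoCat) (n : nat) (X Y : WObj K n) (w : Cell K (wA X) (wA Y))
    : {ffun {set 'I_n.+1} -> Cell K (wA X) (wA Y)} :=
  [ffun p => w].

Definition cube1_wf (K : TwoCat) (n : nat) (X Y : WObj K n)
    (U : {ffun {set 'I_n.+1} -> bar1 K (wA X) (wA Y) * Cell K (wA X) (wA Y)}) : Prop :=
  (forall p : {set 'I_n.+1}, is_mnd1 (cube_mon X p) (cube_mon Y p) (U p).1 (U p).2) /\
  (forall (p : {set 'I_n.+1}) (i : 'I_n.+1), i \notin p ->
     mcomp (cube_edge Y p i) (U (i |: p)) = mcomp (U p) (cube_edge X p i)).

Definition cube2_wf (K : TwoCat) (n : nat) (X Y : WObj K n)
    (U V : {ffun {set 'I_n.+1} -> bar1 K (wA X) (wA Y) * Cell K (wA X) (wA Y)})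
    (Om : {ffun {set 'I_n.+1} -> Cell K (wA X) (wA Y)}) : Prop :=
  (forall p : {set 'I_n.+1}, is_mnd2 (cube_mon X p) (cube_mon Y p) (U p).1 (U p).2 (V p).1 (V p).2 (Om p)) /\
  (forall (p : {set 'I_n.+1}) (i : 'I_n.+1), i \notin p ->
     hcomp (id2 (idh (wA Y))) (Om (i |: p)) = hcomp (Om p) (id2 (idh (wA X)))).

Arguments E2 {K n} X Y w.
Arguments cube1_wf {K n} X Y U.

(* Main.v *)
(* Injectivity, and fullness on 2-cells, are read off the vertices {i} of the cube, where
   the product monad is s_i itself. For fullness on 1-cells one has to see that the
   component psi_I at a vertex I is determined by the psi_{i}.

   Each s_j with j in I acts on s_I from the left: move s_j past the smaller letters with
   the lambda's, then multiply. These actions are compatible with the multiplications and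
   with the lambda's, so that left multiplications A_j by the units satisfy the relations
   A_k A_k = A_k and A_k A_j A_k = A_k A_j for j < k. The idempotent of s_I is the
   product of the A_j in decreasing order and absorbs every A_j on the right, and the
   multiplication of s_I is the iterated action of its letters followed by that idempotent.
   Writing I = i L with i minimal, it follows that s_i -> s_I and s_L -> s_I, multiplied in
   s_I, give the idempotent of s_I. Since psi_I respects multiplication and is compatible
   with the edges, psi_I is assembled from psi_{i} and psi_L, and induction gives the
   formula for xi_I. Multiplying in the other order s_j -> s_{ij} and s_i -> s_{ij} gives
   lambda_{ij}, whence the compatibility of psi_{i} and psi_{j} with the distributive
   laws. *)
Require Import Defs.
From mathcomp Require Import all_boot.
From Stdlib Require Import ProofIrrelevance.

Set Implicit Arguments.
Unset Strict Implicit.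
Unset Printing Implicit Defensive.

(** * Weak distributive laws acting on words *)

(* The word [i0 ... im] stands for [s_i0 ... s_im], and [T i] for horizontal
   composition with [s_i] on the left. [junk] is a default value without any law;
   [lam i j] carries information only for [i < j]. *)
Record wordcat (m : nat) := WordCat {
  Mor : seq 'I_m -> seq 'I_m -> Type;
  junk : forall u w, Mor u w;
  idm : forall w, Mor w w;
  cmp : forall u w x, Mor w x -> Mor u w -> Mor u x;
  T : forall i u w, Mor u w -> Mor (i :: u) (i :: w);
  mu : forall i w, Mor (i :: i :: w) (i :: w);
  eta : forall i w, Mor w (i :: w);
  lam : forall i j w, Mor (j :: i :: w) (i :: j :: w);
  cmpA : forall u w x y (f : Mor x y) (g : Mor w x) (h : Mor u w),
    cmp (cmp f g) h = cmp f (cmp g h);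
  cmp1m : forall u w (f : Mor u w), cmp (idm w) f = f;
  cmpm1 : forall u w (f : Mor u w), cmp f (idm u) = f;
  T_id : forall i w, T i (idm w) = idm (i :: w);
  T_cmp : forall i u w x (f : Mor w x) (g : Mor u w),
    T i (cmp f g) = cmp (T i f) (T i g);
  mu_nat : forall i u w (f : Mor u w),
    cmp (mu i w) (T i (T i f)) = cmp (T i f) (mu i u);
  eta_nat : forall i u w (f : Mor u w),
    cmp (eta i w) f = cmp (T i f) (eta i u);
  lam_nat : forall i j u w (f : Mor u w),
    cmp (lam i j w) (T j (T i f)) = cmp (T i (T j f)) (lam i j u);
  mu_mu : forall i w, cmp (mu i w) (mu i (i :: w)) = cmp (mu i w) (T i (mu i w));
  mu_eta_l : forall i w, cmp (mu i w) (eta i (i :: w)) = idm (i :: w);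
  mu_eta_r : forall i w, cmp (mu i w) (T i (eta i w)) = idm (i :: w);
  lam_mu_l : forall (i j : 'I_m) w, i < j ->
    cmp (lam i j w) (mu j (i :: w)) =
    cmp (T i (mu j w)) (cmp (lam i j (j :: w)) (T j (lam i j w)));
  lam_mu_r : forall (i j : 'I_m) w, i < j ->
    cmp (lam i j w) (T j (mu i w)) =
    cmp (mu i (j :: w)) (cmp (T i (lam i j w)) (lam i j (i :: w)));
  lam_eta_l : forall (i j : 'I_m) w, i < j ->
    cmp (lam i j w) (eta j (i :: w)) =
    cmp (mu i (j :: w)) (cmp (T i (lam i j w))
      (cmp (T i (T j (eta i w))) (T i (eta j w))));
  lam_eta_r : forall (i j : 'I_m) w, i < j ->
    cmp (lam i j w) (T j (eta i w)) =
    cmp (T i (mu j w)) (cmp (lam i j (j :: w))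
      (cmp (eta j (i :: j :: w)) (eta i (j :: w))));
  yang_baxter : forall (i j k : 'I_m) w, i < j -> j < k ->
    cmp (lam i j (k :: w)) (cmp (T j (lam i k w)) (lam j k (i :: w))) =
    cmp (T i (lam j k w)) (cmp (lam i k (j :: w)) (T k (lam i j w)))
}.

Arguments Mor {m}.
Arguments junk {m W} u w : rename.
Arguments idm {m W} w : rename.
Arguments cmp {m W u w x} : rename.
Arguments T {m W} i {u w} : rename.
Arguments mu {m W} i w : rename.
Arguments eta {m W} i w : rename.
Arguments lam {m W} i j w : rename.

Local Notation "f ∘ g" := (cmp f g) (at level 39, right associativity).

Section WordCatTheory.
Variables (m : nat) (W : wordcat m).
Implicit Types (i j k : 'I_m) (u w x l : seq 'I_m).

(** Composites are kept associated to the right. [after], [after2] and [after3] apply an equation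
    between short composites when a further factor follows on the right. *)
Let after u w x y (f : Mor W w x) (g : Mor W u w) (h : Mor W u x)
    (e : f ∘ g = h) (z : Mor W y u) : f ∘ g ∘ z = h ∘ z.
Proof. by rewrite -cmpA e. Qed.

Let after2 u w w' x y (f : Mor W w x) (g : Mor W u w) (h : Mor W w' x) (h' : Mor W u w')
    (e : f ∘ g = h ∘ h') (z : Mor W y u) : f ∘ g ∘ z = h ∘ h' ∘ z.
Proof. by rewrite -!cmpA e. Qed.

Let after3 u w w' x y z (f : Mor W w x) (g : Mor W u w) (g' : Mor W y u)
    (h : Mor W w' x) (h' : Mor W y w')
    (e : f ∘ g ∘ g' = h ∘ h') (t : Mor W z y) : f ∘ g ∘ g' ∘ t = h ∘ h' ∘ t.
Proof. by rewrite -(cmpA h) -e !cmpA. Qed.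

(** The letter [j] passes other letters by [lam] and multiplies into the first [j] it meets; without
    such a letter the value is junk. The equality test is matched dependently because [mu] has to be
    transported along [i = j]. *)
Fixpoint act j w : Mor W (j :: w) w :=
  match w with
  | [::] => junk _ _
  | i :: w' =>
      match @eqP _ i j with
      | ReflectT e =>
          match e in _ = k return Mor W (k :: i :: w') (i :: w') with
          | erefl => mu i w'
          end
      | ReflectF _ => T i (act j w') ∘ lam i j w'
      end
  end.

(* [acts j w]: the letter [j] occurs in [w], preceded by smaller letters only. *)
Fixpoint acts j w : bool :=
  if w is i :: w' then (i == j) || (i < j) && acts j w' else false.

Lemma act_hd j w : act j (j :: w) = mu j w.
Proof. by rewrite /=; case: eqP => // e; rewrite (eq_irrelevance e erefl). Qed.

Lemma act_tl i j w : i < j -> act j (i :: w) = T i (act j w) ∘ lam i j w.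
Proof. by move=> ij /=; case: eqP => // e; exfalso; rewrite e ltnn in ij. Qed.

Arguments act : simpl never.

(** Associativity of the action. At the letter [j] it is associativity of [s_j]; before it,
    [lam_mu_l] carries the multiplication past a smaller letter. *)
Lemma act_mu j w : acts j w -> act j w ∘ mu j w = act j w ∘ T j (act j w).
Proof.
elim: w => // i w IH /= /orP[/eqP-> | /andP[ij /IH {}IH]].
  by rewrite act_hd mu_mu.
rewrite (act_tl _ ij) T_cmp !cmpA lam_mu_l // (after2 (lam_nat _ _ _)).
by rewrite -!(cmpA (T i (act j w))) -!T_cmp IH.
Qed.

(** Letters smaller than [j] are passed by Yang-Baxter; at the letter [j] itself the claim reduces
    to [lam_mu_r]. *)
Lemma act_lam j k w : j < k -> acts j w -> acts k w ->
  act j w ∘ T j (act k w) ∘ lam j k w = act k w ∘ T k (act j w).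
Proof.
move=> jk; elim: w => // i w IH /= /orP[/eqP-> _ | /andP[ij jw]].
  rewrite act_hd act_tl // T_cmp !cmpA lam_mu_r //.
  by rewrite (after2 (mu_nat _ _)).
have ik := ltn_trans ij jk.
rewrite -val_eqE /= (ltn_eqF ik) /= => /andP[_ kw].
rewrite !act_tl // !T_cmp !cmpA.
rewrite (after2 (lam_nat _ _ _)) yang_baxter // (after2 (lam_nat _ _ _)).
have e := congr1 (T i) (IH jw kw); rewrite !T_cmp in e.
by rewrite (after3 e).
Qed.

(* Left multiplication by the unit of [s_j]; locked, to keep [cmpA] from
   unfolding it. *)
Definition lunit j w : Mor W w w := locked (act j w ∘ eta j w).

Lemma lunitE j w : lunit j w = act j w ∘ eta j w.
Proof. by rewrite /lunit -lock. Qed.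

Lemma lunit_hd j w : lunit j (j :: w) = idm _.
Proof. by rewrite lunitE act_hd mu_eta_l. Qed.

Lemma act_T_lunit j w : acts j w -> act j w ∘ T j (lunit j w) = act j w.
Proof.
by move=> jw; rewrite lunitE T_cmp (after2 (esym (act_mu jw))) mu_eta_r cmpm1.
Qed.

Lemma lunit_act j w : acts j w -> lunit j w ∘ act j w = act j w.
Proof.
move=> jw; rewrite lunitE cmpA eta_nat (after2 (esym (act_mu jw))).
by rewrite mu_eta_l cmpm1.
Qed.

Lemma lunit_idem j w : acts j w -> lunit j w ∘ lunit j w = lunit j w.
Proof. by move=> jw; rewrite {2}lunitE (after (lunit_act jw)) lunitE. Qed.

Section TwoLetters.
Variables (j k : 'I_m) (w : seq 'I_m).
Hypotheses (jk : j < k) (jw : acts j w) (kw : acts k w).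

(** Naturality and [act_lam] bring the unit of [s_k] next to [lam j k], where [lam_eta_l] trades it
    for units of both letters; a second use of [act_lam] turns these into left multiplications. *)
Lemma lunit_act_gt : lunit k w ∘ act j w = act j w ∘ T j (lunit k w ∘ lunit j w).
Proof.
rewrite (lunitE k) cmpA eta_nat (after2 (esym (act_lam jk jw kw))) !cmpA lam_eta_l //.
rewrite (after2 (esym (mu_nat _ _))) (after2 (act_mu jw)).
rewrite -!T_cmp (after3 (act_lam jk jw kw)).
by rewrite (eta_nat _ (lunit j w)) (lunitE j) (T_cmp k) cmpA.
Qed.

(** The companion of [lunit_act_gt], with [lam_eta_r] applied to the unit of [s_j]. *)
Lemma act_T_lunit_lt : act k w ∘ T k (lunit j w) = lunit k w ∘ lunit j w ∘ act k w.
Proof.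
rewrite !lunitE T_cmp (after2 (esym (act_lam jk jw kw))) !cmpA lam_eta_r //.
rewrite -(cmpA (T j (act k w))) -T_cmp act_mu // T_cmp !cmpA.
rewrite (after2 (esym (lam_nat _ _ _))) (after3 (act_lam jk jw kw)).
by rewrite (eta_nat j (act k w)) (after2 (eta_nat k (act j w)))
  (after2 (eta_nat k (T j _))).
Qed.

(* With idempotency, this is the half of the relations of Kiselman's monoid that
   makes the decreasing product [bar] absorb each of its factors. *)
Lemma lunit_lunit_lunit : lunit k w ∘ lunit j w ∘ lunit k w = lunit k w ∘ lunit j w.
Proof.
rewrite [in RHS](lunitE k) cmpA (eta_nat k (lunit j w)).
by rewrite -(cmpA (act k w)) act_T_lunit_lt (lunitE k) !cmpA.
Qed.

End TwoLetters.

(** * Increasing words and their idempotents *)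

Definition inc l := pairwise (fun i j => i < j) l.

Lemma acts_mem j w : inc w -> j \in w -> acts j w.
Proof.
elim: w => // i w IH /= /andP[/allP iw incw].
rewrite inE eq_sym => /orP[-> // | jw]; by rewrite (iw _ jw) IH ?orbT.
Qed.

Lemma acts_cat j u w : acts j u -> acts j (u ++ w).
Proof.
by elim: u => //= i u IH /orP[-> // | /andP[-> /IH->]]; rewrite orbT.
Qed.

(* For [l] increasing, the units act in increasing order, as in the recursive
   definition of the idempotent of [s_l]. *)
Fixpoint bar l w : Mor W w w := if l is j :: l' then bar l' w ∘ lunit j w else idm w.

(** For [j] in the tail, [bar l] supplies a [lunit j] to the left of [lunit i], and
    [lunit_lunit_lunit] then swallows the [lunit j] on the right. *)
Lemma bar_lunit l w j : inc l -> all (acts^~ w) l -> j \in l ->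
  bar l w ∘ lunit j w = bar l w.
Proof.
elim: l => // i l IH /= /andP[/allP il incl] /andP[iw lw].
rewrite inE => /predU1P[-> | jl]; first by rewrite cmpA lunit_idem.
have jw := allP lw _ jl.
by rewrite -(IH incl lw jl) !cmpA lunit_lunit_lunit // il.
Qed.

Lemma bar_rcons l w k : bar (rcons l k) w = lunit k w ∘ bar l w.
Proof. by elim: l => [|i l IH] /=; rewrite ?cmp1m ?cmpm1 // IH cmpA. Qed.

Lemma absorb_bar u w l (f : Mor W w u) : (forall j, j \in l -> f ∘ lunit j w = f) ->
  f ∘ bar l w = f.
Proof.
elim: l => [|i l IH] fl /=; first by rewrite cmpm1.
rewrite -cmpA IH; first by rewrite fl ?mem_head.
by move=> j jl; rewrite fl // inE jl orbT.
Qed.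

Lemma bar_idem l w : inc l -> all (acts^~ w) l -> bar l w ∘ bar l w = bar l w.
Proof. by move=> *; apply: absorb_bar => j jl; rewrite bar_lunit. Qed.

(** The inner [lunit j] slides through [eta j] and [lam i j] until it meets [act j w], which absorbs
    it. *)
Lemma lunit_T_lunit i j w : i < j -> acts j w ->
  lunit j (i :: w) ∘ T i (lunit j w) = lunit j (i :: w).
Proof.
move=> ij jw; rewrite {1}lunitE cmpA eta_nat act_tl // cmpA (after2 (lam_nat _ _ _)).
by rewrite -(cmpA (T i (act j w))) -T_cmp act_T_lunit // lunitE act_tl // cmpA.
Qed.

Lemma absorb_T_bar u i l w (f : Mor W (i :: w) u) :
  all (fun j => i < j) l -> all (acts^~ w) l ->
  (forall j, j \in l -> f ∘ lunit j (i :: w) = f) -> f ∘ T i (bar l w) = f.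
Proof.
elim: l => [|k l IH] /=; first by rewrite T_id cmpm1.
move=> /andP[ik il] /andP[kw lw] fl; rewrite T_cmp -cmpA IH //; last first.
  by move=> j jl; rewrite fl // inE jl orbT.
by rewrite -(fl k) ?mem_head // cmpA lunit_T_lunit.
Qed.

(** In an induction on words, this removes the idempotent contributed by the shorter word. *)
Lemma bar_T_bar i l : inc (i :: l) ->
  bar (i :: l) (i :: l) ∘ T i (bar l l) = bar (i :: l) (i :: l).
Proof.
move=> incl; have /andP[il incl'] := incl.
have acl : all (acts^~ (i :: l)) (i :: l) by apply/allP=> j; apply: acts_mem.
apply: absorb_T_bar => // [|j jl]; first by apply/allP=> j; apply: acts_mem.
by rewrite bar_lunit // inE jl orbT.
Qed.

(** For [j < k], a [lunit k] borrowed from [bar l w] is pushed through [act j w] and swallows the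
    given one. For [k < j], the given one comes out on the left as [lunit j w ∘ lunit k w], which
    [bar l w] absorbs. *)
Lemma bar_act_T_lunit l w j k : inc l -> all (acts^~ w) l -> j \in l -> k \in l ->
  bar l w ∘ act j w ∘ T j (lunit k w) = bar l w ∘ act j w.
Proof.
move=> incl lw jl kl; have [jw kw] := (allP lw _ jl, allP lw _ kl).
case: (ltngtP j k) => [jk | kj | /val_inj <-]; last by rewrite act_T_lunit.
- rewrite -(bar_lunit incl lw kl) !cmpA (after2 (lunit_act_gt jk jw kw)) -T_cmp cmpA.
  by rewrite lunit_lunit_lunit // lunit_act_gt.
- rewrite act_T_lunit_lt // -!cmpA; congr (_ ∘ _).
  by rewrite bar_lunit ?bar_lunit.
Qed.

Lemma bar_act_T_bar l w j : inc l -> all (acts^~ w) l -> j \in l ->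
  bar l w ∘ act j w ∘ T j (bar l w) = bar l w ∘ act j w.
Proof.
move=> incl lw jl; rewrite -cmpA.
(* The inner product is generalised to any word [r] of letters of [l], since induction on [l] would
   also change the outer [bar l w]. *)
suff: forall r, {subset r <= l} ->
  (bar l w ∘ act j w) ∘ T j (bar r w) = bar l w ∘ act j w by apply.
elim=> [|k r IH] rl /=; first by rewrite T_id cmpm1.
rewrite T_cmp -cmpA IH; last by move=> i ir; rewrite rl // inE ir orbT.
by rewrite cmpA bar_act_T_lunit // rl ?mem_head.
Qed.

(** * The iterated action and products of units *)

Fixpoint Act l w : Mor W (l ++ w) w :=
  if l is j :: l' then act j w ∘ T j (Act l' w) else idm w.

(** For the head of [l] this is associativity of its action; a later letter is exchanged with the
    head by [act_lam]. *)
Lemma Act_act l w k : inc l -> all (acts^~ w) l -> k \in l ->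
  Act l w ∘ act k (l ++ w) = act k w ∘ T k (Act l w).
Proof.
elim: l => // j l IH /= /andP[/allP jl incl] /andP[jw lw].
rewrite inE => /predU1P[-> | kl].
  by rewrite act_hd cmpA -mu_nat (after2 (act_mu jw)) T_cmp.
have jk := jl _ kl; have kw := allP lw _ kl.
rewrite act_tl // cmpA -(cmpA (T j (Act l w))) -T_cmp IH // T_cmp !cmpA.
by rewrite -lam_nat (after3 (act_lam jk jw kw)) T_cmp.
Qed.

Lemma Act_lunit l w k : inc l -> all (acts^~ w) l -> k \in l ->
  Act l w ∘ lunit k (l ++ w) = lunit k w ∘ Act l w.
Proof. by move=> *; rewrite !lunitE -cmpA Act_act // !cmpA eta_nat. Qed.

(** Each [lunit] on [l ++ w] passes through [Act l w] and is then absorbed by [bar l w]. *)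
Lemma bar_Act_bar l w : inc l -> all (acts^~ w) l ->
  bar l w ∘ Act l w ∘ bar l (l ++ w) = bar l w ∘ Act l w.
Proof.
move=> incl lw; rewrite -cmpA; apply: absorb_bar => j jl.
by rewrite cmpA Act_lunit // -cmpA bar_lunit.
Qed.

Fixpoint etas l w : Mor W w (l ++ w) :=
  if l is j :: l' then eta j (l' ++ w) ∘ etas l' w else idm w.

(** Letters inserted by units and then consumed by [Act r w] amount to a product of [lunit]s, which
    [bar_act_T_lunit] removes one at a time. *)
Lemma bar_act_etas l r w j : inc l -> all (acts^~ w) l -> j \in l ->
  {subset r <= l} ->
  bar l w ∘ act j w ∘ T j (Act r w ∘ etas r w) = bar l w ∘ act j w.
Proof.
move=> incl lw jl; elim: r => [|k r IH] rl /=; first by rewrite cmp1m T_id cmpm1.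
rewrite cmpA (after2 (esym (eta_nat _ _))) -(cmpA (act k w)) -lunitE T_cmp.
rewrite -!(cmpA (bar l w)) -(cmpA (bar l w ∘ act j w)) (cmpA (bar l w)).
rewrite bar_act_T_lunit ?(rl k) ?mem_head // cmpA IH // => i ir.
by rewrite rl // inE ir orbT.
Qed.

(* Multiplying the images of [s_i] and [s_l] in the product monad [s_I]. *)
Lemma mul_first_rest i l : let I := i :: l in inc I ->
  (bar I I ∘ Act I I) ∘ (bar I (I ++ I) ∘ T i (etas l I)) ∘ T i (bar I I ∘ eta i l)
  = bar I I.
Proof.
move=> I incI; have acI : all (acts^~ I) I by apply/allP=> j; apply: acts_mem.
have iI : i \in I := mem_head _ _.
have lI : {subset l <= I} by move=> j jl; rewrite inE jl orbT.
move: (bar I I) (bar I (I ++ I)) (bar_Act_bar incI acI)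
  (bar_act_etas incI acI iI lI) (bar_act_T_bar incI acI iI) => b B e1 e2 e3.
rewrite (cmpA B) -(cmpA (b ∘ _)) (cmpA b) e1 /= !cmpA -/I.
rewrite -(cmpA (T i (Act l I))) -T_cmp -(cmpA (act i I)) -cmpA e2.
by rewrite T_cmp -!cmpA (cmpA b) e3 /I act_hd cmpA mu_eta_r cmpm1.
Qed.

Lemma bar2 i j : bar [:: i; j] [:: i; j] = lunit j [:: i; j].
Proof. by rewrite /= cmp1m lunit_hd cmpm1. Qed.

(** In this order the unit of [s_i] contributes only a [lunit i], absorbed by the idempotent. On two
    letters the idempotent is [lunit j], absorbed by [act j]. What remains is [lam i j] together
    with a multiplication of [s_j] against its unit. *)
Lemma mul_second_first i j : i < j -> let I := [:: i; j] in
  (bar I I ∘ Act I I) ∘ (bar I (I ++ I) ∘ eta i (j :: I)) ∘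
    T j (bar I I ∘ T i (eta j [::]))
  = lam i j [::].
Proof.
move=> ij I; have incI : inc I by rewrite /I /= ij.
have acI : all (acts^~ I) I by apply/allP=> k; apply: acts_mem.
have iI : i \in I := mem_head _ _.
have jI : j \in I by rewrite !inE eqxx orbT.
have e4 : bar I I ∘ act j I = act j I by rewrite bar2 lunit_act // (allP acI).
move: (bar I I) (bar I (I ++ I)) (bar_Act_bar incI acI) (bar_lunit incI acI iI)
  (bar_act_T_bar incI acI jI) e4 => b B e1 e2 e3 e4.
rewrite (cmpA B) -(cmpA (b ∘ _)) (cmpA b) e1 /= T_id cmpm1 -/I !cmpA.
rewrite (after2 (esym (eta_nat _ _))) -(cmpA (act i I)) -lunitE -(cmpA b) e2.
rewrite T_cmp -!cmpA (cmpA b) e3 e4 /I act_tl // act_hd cmpA lam_nat -cmpA -T_cmp.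
by rewrite mu_eta_r T_id cmp1m.
Qed.

(* The idempotent of a weak distributive law, once through the unit of [s_j] and once
   through that of [s_i]. *)
Lemma lunit_mirror i j w : i < j ->
  lunit j [:: i, j & w] = mu i (j :: w) ∘ T i (lam i j w) ∘ T i (T j (eta i w)).
Proof.
move=> ij; have [iw jw] : acts i [:: i, j & w] /\ acts j [:: i, j & w].
  by rewrite /= !eqxx ij orbT.
rewrite -[LHS]cmpm1 -(mu_eta_r W i (j :: w)) -act_hd (after2 (lunit_act_gt ij iw jw)).
rewrite lunit_hd cmpm1 -T_cmp act_hd -T_cmp lam_eta_r // lunitE act_tl // act_hd.
by rewrite !cmpA.
Qed.

(** * Moving a letter past a prefix of smaller letters *)

Fixpoint TT p u w (f : Mor W u w) : Mor W (p ++ u) (p ++ w) :=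
  if p is i :: p' then T i (TT p' f) else f.

Fixpoint past j p w : Mor W (j :: p ++ w) (p ++ j :: w) :=
  if p is i :: p' then T i (past j p' w) ∘ lam i j (p' ++ w) else idm (j :: w).

(** Moving [j] next to another [j] and multiplying there is the action of [j]. The morphism [f] is
    carried along so that letters further right can be multiplied at the same time. *)
Lemma TT_mu_past p j u w (f : Mor W u w) : all (fun i => i < j) p ->
  TT p (mu j w ∘ T j (T j f)) ∘ past j p (j :: u) =
  act j (p ++ j :: w) ∘ T j (TT p (T j f)).
Proof.
elim: p => [|i p IH] /=; first by rewrite cmpm1 act_hd.
case/andP=> ij /IH e; rewrite act_tl // -cmpA -T_cmp e T_cmp !cmpA.
by rewrite lam_nat.
Qed.

End WordCatTheory.

Arguments act [m] W j w : simpl never.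
Arguments acts {m} j w.

(** * The local idempotent closure *)

Create HintDb bnd.
Ltac bnd := by autorewrite with bnd.
Hint Rewrite src_hcomp tgt_hcomp src_id2 tgt_id2 comp_assoc comp_id_l comp_id_r : bnd.
Hint Rewrite src_vcomp tgt_vcomp using bnd : bnd.

Section Bar.
Variable K : TwoCat.
Implicit Types A B C D : Ob K.

Lemma barcompA A B C D (x : bar1 K C D) (y : bar1 K B C) (z : bar1 K A B) :
  barcomp (barcomp x y) z = barcomp x (barcomp y z).
Proof. by rewrite /barcomp /= comp_assoc hcomp_assoc. Qed.

Lemma barcomp1x A B (x : bar1 K A B) : barcomp (barid B) x = x.
Proof. by case: x => v e; rewrite /barcomp /= comp_id_l hcomp_id_l. Qed.

Lemma barcompx1 A B (x : bar1 K A B) : barcomp x (barid A) = x.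
Proof. by case: x => v e; rewrite /barcomp /= comp_id_r hcomp_id_r. Qed.

Lemma b1_barcomp A B C (x : bar1 K B C) (y : bar1 K A B) :
  b1 (barcomp x y) = Defs.comp (b1 x) (b1 y).
Proof. by []. Qed.

Lemma b1_barid A : b1 (barid A) = idh A.
Proof. by []. Qed.

Lemma b1_Bar1 A B v e : b1 (@Bar1 K A B v e) = v.
Proof. by []. Qed.

Lemma wf_barid A : wf1 (barid A).
Proof. by have := vcomp_id_r (id2 (idh A)); rewrite /wf1 /= src_id2 tgt_id2. Qed.

Definition hom A B (f : Cell K A B) (x y : bar1 K A B) :=
  [/\ wf1 x, wf1 y & is2 f x y].

Section Hom.
Variables (A B : Ob K).
Implicit Types (f g : Cell K A B) (x y z : bar1 K A B).

Lemma hom_bb x : wf1 x -> hom (bb x) x x.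
Proof. by move=> wx; split=> //; case: wx => ? []. Qed.

Lemma hom_src f x y : hom f x y -> src f = b1 x.
Proof. by case=> _ _ []. Qed.

Lemma hom_tgt f x y : hom f x y -> tgt f = b1 y.
Proof. by case=> _ _ [_ []]. Qed.

Lemma hom_bb_l f x y : hom f x y -> vcomp (bb y) f = f.
Proof. by case=> _ _ [_ [_ []]]. Qed.

Lemma hom_bb_r f x y : hom f x y -> vcomp f (bb x) = f.
Proof. by case=> _ _ [_ [_ []]]. Qed.

Lemma hom_st f g x y z : hom g x y -> hom f y z -> tgt g = src f.
Proof. by move=> /hom_tgt-> /hom_src->. Qed.

Lemma hom_vcomp f g x y z : hom f y z -> hom g x y -> hom (vcomp f g) x z.
Proof.
move=> hf hg; have [wy wz _] := hf; have [wx _ _] := hg.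
have gf := hom_st hg hf; split=> //.
have zz := hom_st hf (hom_bb wz); have xx := hom_st (hom_bb wx) hg.
rewrite /is2 src_vcomp // tgt_vcomp // (hom_src hg) (hom_tgt hf).
by rewrite -vcomp_assoc // (hom_bb_l hf) vcomp_assoc // (hom_bb_r hg).
Qed.

End Hom.

Lemma src_bb A B (x : bar1 K A B) : wf1 x -> src (bb x) = b1 x.
Proof. by case. Qed.

Lemma tgt_bb A B (x : bar1 K A B) : wf1 x -> tgt (bb x) = b1 x.
Proof. by case=> _ []. Qed.

Lemma bb_idem A B (x : bar1 K A B) : wf1 x -> vcomp (bb x) (bb x) = bb x.
Proof. by case=> _ []. Qed.

(** Whiskering by a 1-cell of the closure is horizontal composition with its idempotent, and
    idempotency is what makes it preserve vertical composites. *)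
Lemma whisker_l A B C (x : bar1 K B C) f g : wf1 x -> tgt g = src f ->
  hcomp (bb x) (@vcomp K A B f g) = vcomp (hcomp (bb x) f) (hcomp (bb x) g).
Proof.
by move=> wx gf; rewrite -Defs.interchange // ?bb_idem // src_bb ?tgt_bb.
Qed.

Lemma whisker_r A B C (p : bar1 K A B) f g : wf1 p -> tgt g = src f ->
  hcomp (@vcomp K B C f g) (bb p) = vcomp (hcomp f (bb p)) (hcomp g (bb p)).
Proof.
by move=> wp gf; rewrite -Defs.interchange // ?bb_idem // src_bb ?tgt_bb.
Qed.

Lemma hom_hcomp A B C (x x' : bar1 K B C) (y y' : bar1 K A B) f g :
  hom f x x' -> hom g y y' -> hom (hcomp f g) (barcomp x y) (barcomp x' y').
Proof.
have wc (u : bar1 K B C) (w : bar1 K A B) : wf1 u -> wf1 w -> wf1 (barcomp u w).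
  move=> wu ww; split; first by rewrite src_hcomp /= !src_bb.
  split; first by rewrite tgt_hcomp /= !tgt_bb.
  by rewrite /= -Defs.interchange ?bb_idem // !(src_bb, tgt_bb).
move=> hf hg; have [wx wx' _] := hf; have [wy wy' _] := hg.
split; [exact: wc | exact: wc | split; first by rewrite src_hcomp (hom_src hf) (hom_src hg)].
split; first by rewrite tgt_hcomp (hom_tgt hf) (hom_tgt hg).
split=> /=; rewrite -Defs.interchange ?(hom_bb_l hf, hom_bb_l hg, hom_bb_r hf, hom_bb_r hg) //.
all: by rewrite ?(src_bb, tgt_bb, hom_src hf, hom_tgt hf, hom_src hg, hom_tgt hg).
Qed.

Lemma wf_barcomp A B C (x : bar1 K B C) (y : bar1 K A B) :
  wf1 x -> wf1 y -> wf1 (barcomp x y).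
Proof. by move=> /hom_bb hx /hom_bb hy; case: (hom_hcomp hx hy). Qed.

Section Slide.
Variables (A B C : Ob K) (x y : bar1 K B C) (p q : bar1 K A B).
Variables (f : Cell K B C) (g : Cell K A B).
Hypotheses (hf : hom f x y) (hg : hom g p q).

Lemma slide_l : vcomp (hcomp f (bb q)) (hcomp (bb x) g) = hcomp f g.
Proof.
have [[wx _ _] [_ wq _]] := (hf, hg); rewrite -Defs.interchange.
- by rewrite (hom_bb_r hf) (hom_bb_l hg).
- by rewrite tgt_bb // (hom_src hf).
- by rewrite src_bb // (hom_tgt hg).
Qed.

Lemma slide_r : vcomp (hcomp (bb y) g) (hcomp f (bb p)) = hcomp f g.
Proof.
have [[_ wy _] [wp _ _]] := (hf, hg); rewrite -Defs.interchange.
- by rewrite (hom_bb_l hf) (hom_bb_r hg).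
- by rewrite src_bb // (hom_tgt hf).
- by rewrite tgt_bb // (hom_src hg).
Qed.

End Slide.
End Bar.

Hint Rewrite b1_barcomp b1_barid b1_Bar1 : bnd.

(** * The word category of a family of weak distributive laws *)

Section Words.
Variables (K : TwoCat) (A : Ob K) (n : nat) (s : 'I_n.+1 -> Mon K A)
  (l : 'I_n.+1 -> 'I_n.+1 -> Cell K A A).
Hypothesis monad_s : forall i, is_monad (s i).
Hypothesis wdl_l : forall i j : 'I_n.+1, i < j -> is_wdl (s j) (s i) (l i j).
Hypothesis yb_l : forall i j k : 'I_n.+1, i < j -> j < k ->
  let sb l := bb (mt (s l)) in
  vcomp (hcomp (l i j) (sb k)) (vcomp (hcomp (sb j) (l i k)) (hcomp (l j k) (sb i)))
  = vcomp (hcomp (sb i) (l j k)) (vcomp (hcomp (l i k) (sb j)) (hcomp (sb k) (l i j))).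

Implicit Types (i j k : 'I_n.+1) (u w : seq 'I_n.+1).

Local Notation t i := (mt (s i)).
Local Notation b i := (bb (mt (s i))).
Local Notation obj w := (Bar1 (sw s w) (sbw s w)).

Lemma wf_t i : wf1 (t i).
Proof. by case: (monad_s i). Qed.

Lemma hom_b i : hom (b i) (t i) (t i).
Proof. exact/hom_bb/wf_t. Qed.

Lemma hom_mmu i : hom (mmu (s i)) (barcomp (t i) (t i)) (t i).
Proof. by case: (monad_s i) => *; split=> //; apply: wf_barcomp. Qed.

Lemma hom_meta i : hom (meta (s i)) (barid A) (t i).
Proof. by case: (monad_s i) => *; split=> //; apply: wf_barid. Qed.

Lemma hom_l i j : i < j -> hom (l i j) (barcomp (t j) (t i)) (barcomp (t i) (t j)).
Proof. by case/wdl_l=> *; split=> //; apply: wf_barcomp; apply: wf_t. Qed.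

Lemma wf_obj w : wf1 (obj w).
Proof. by elim: w => [|i w /(wf_barcomp (wf_t i))] //; apply: wf_barid. Qed.

Lemma hom_sbw w : hom (sbw s w) (obj w) (obj w).
Proof. exact/(hom_bb (x := obj w))/wf_obj. Qed.

Definition src_b i := hom_src (hom_b i).
Definition tgt_b i := hom_tgt (hom_b i).
Definition src_mmu i := hom_src (hom_mmu i).
Definition tgt_mmu i := hom_tgt (hom_mmu i).
Definition src_meta i := hom_src (hom_meta i).
Definition tgt_meta i := hom_tgt (hom_meta i).
Definition src_l i j ij := hom_src (@hom_l i j ij).
Definition tgt_l i j ij := hom_tgt (@hom_l i j ij).
Definition src_sbw w := hom_src (hom_sbw w).
Definition tgt_sbw w := hom_tgt (hom_sbw w).
Hint Rewrite src_b tgt_b src_mmu tgt_mmu src_meta tgt_meta src_sbw tgt_sbw : bnd.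
Hint Rewrite src_l tgt_l using assumption : bnd.

Lemma whisker_sbw w (f g : Cell K A A) : tgt g = src f ->
  hcomp (vcomp f g) (sbw s w) = vcomp (hcomp f (sbw s w)) (hcomp g (sbw s w)).
Proof. exact: (whisker_r (p := obj w)) (wf_obj w). Qed.

(* [None] is the junk value of [act] and of [lam]. *)
Definition wmor u w := option {c : Cell K A A | hom c (obj u) (obj w)}.

Definition mk u w c (hc : hom c (obj u) (obj w)) : wmor u w :=
  Some (exist (fun c => hom c (obj u) (obj w)) c hc).

(** This also says that [h] is not junk. Equations pass from words to cells of [K] by [rep_inj] and
    back by [rep_eq]. *)
Definition rep u w (h : wmor u w) (c : Cell K A A) := omap sval h = Some c.

Lemma rep_hom u w (h : wmor u w) c : rep h c -> hom c (obj u) (obj w).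
Proof. by case: h => // -[d hd] [<-]. Qed.

Lemma rep_eq u w (h h' : wmor u w) c c' : rep h c -> rep h' c' -> c = c' -> h = h'.
Proof.
case: h h' => [[d hd]|] [[d' hd']|] //= [<-] [<-] e; move: hd; rewrite [d]e => hd.
by rewrite (proof_irrelevance _ hd hd').
Qed.

Lemma rep_inj u w (h h' : wmor u w) c c' : rep h c -> rep h' c' -> h = h' -> c = c'.
Proof. by rewrite /rep => ? + e; rewrite -e => ?; apply: Some_inj; congruence. Qed.

Definition wid w : wmor w w := mk (hom_sbw w).

Definition wcmp u w x (f : wmor w x) (g : wmor u w) : wmor u x :=
  match f, g with
  | Some (exist f hf), Some (exist g hg) => mk (hom_vcomp hf hg)
  | _, _ => None
  end.

Definition wT i u w (f : wmor u w) : wmor (i :: u) (i :: w) :=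
  if f is Some (exist f hf) then @mk (i :: u) (i :: w) _ (hom_hcomp (hom_b i) hf) else None.

Lemma hom_wmu i w : hom (hcomp (mmu (s i)) (sbw s w)) (obj (i :: i :: w)) (obj (i :: w)).
Proof.
rewrite -[obj (i :: i :: w)]/(barcomp (t i) (barcomp (t i) (obj w))) -barcompA.
exact: (hom_hcomp (hom_mmu i) (hom_sbw w)).
Qed.

Lemma hom_weta i w : hom (hcomp (meta (s i)) (sbw s w)) (obj w) (obj (i :: w)).
Proof. by rewrite -(barcomp1x (obj w)); apply: (hom_hcomp (hom_meta i) (hom_sbw w)). Qed.

Lemma hom_wlam i j w : i < j ->
  hom (hcomp (l i j) (sbw s w)) (obj (j :: i :: w)) (obj (i :: j :: w)).
Proof.
move=> ij; rewrite -[obj (j :: i :: w)]/(barcomp (t j) (barcomp (t i) (obj w))) -barcompA.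
rewrite -[obj (i :: j :: w)]/(barcomp (t i) (barcomp (t j) (obj w))) -barcompA.
exact: (hom_hcomp (hom_l ij) (hom_sbw w)).
Qed.

Definition wmu i w : wmor (i :: i :: w) (i :: w) := mk (hom_wmu i w).
Definition weta i w : wmor w (i :: w) := mk (hom_weta i w).
Definition wlam i j w : wmor (j :: i :: w) (i :: j :: w) :=
  if decP (@idP (i < j)) is left ij then mk (hom_wlam w ij) else None.

Lemma rep_id w : rep (wid w) (sbw s w). Proof. by []. Qed.
Lemma rep_cmp u w x (f : wmor w x) (g : wmor u w) c d :
  rep f c -> rep g d -> rep (wcmp f g) (vcomp c d).
Proof. by case: f g => [[f hf]|] [[g hg]|] //= [<-] [<-]. Qed.
Lemma rep_T i u w (f : wmor u w) c : rep f c -> rep (wT i f) (hcomp (b i) c).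
Proof. by case: f => [[f hf]|] //= [<-]. Qed.
Lemma rep_mu i w : rep (wmu i w) (hcomp (mmu (s i)) (sbw s w)). Proof. by []. Qed.
Lemma rep_eta i w : rep (weta i w) (hcomp (meta (s i)) (sbw s w)). Proof. by []. Qed.
Lemma rep_lam i j w : i < j -> rep (wlam i j w) (hcomp (l i j) (sbw s w)).
Proof. by move=> ij; rewrite /wlam; case: decP. Qed.

Ltac rep := repeat first [exact: rep_id | exact: rep_mu | exact: rep_eta
  | apply: rep_lam; assumption | apply: rep_T | apply: rep_cmp | assumption].

Lemma wcmpA u w x y (f : wmor x y) (g : wmor w x) (h : wmor u w) :
  wcmp (wcmp f g) h = wcmp f (wcmp g h).
Proof.
case: f g h => [[f hf]|] [[g hg]|] [[h hh]|] //; apply: rep_eq.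
- by [].
- by [].
- by rewrite /= vcomp_assoc ?(hom_st hh hg) ?(hom_st hg hf).
Qed.

Lemma wcmp1m u w (f : wmor u w) : wcmp (wid w) f = f.
Proof. by case: f => [[f hf]|] //; apply: rep_eq; [by [] | by [] | apply: (hom_bb_l hf)]. Qed.

Lemma wcmpm1 u w (f : wmor u w) : wcmp f (wid u) = f.
Proof. by case: f => [[f hf]|] //; apply: rep_eq; [by [] | by [] | apply: (hom_bb_r hf)]. Qed.

Lemma wT_id i w : wT i (wid w) = wid (i :: w).
Proof. by apply: rep_eq. Qed.

Lemma wT_cmp i u w x (f : wmor w x) (g : wmor u w) :
  wT i (wcmp f g) = wcmp (wT i f) (wT i g).
Proof.
case: f g => [[f hf]|] [[g hg]|] //; apply: rep_eq; [by [] | by [] |].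
exact: whisker_l (wf_t i) (hom_st hg hf).
Qed.

Lemma wmu_nat i u w (f : wmor u w) :
  wcmp (wmu i w) (wT i (wT i f)) = wcmp (wT i f) (wmu i u).
Proof.
case: f => [[f hf]|] //; apply: rep_eq; [by [] | by [] |].
by rewrite /= -hcomp_assoc (slide_l (hom_mmu i) hf) (slide_r (hom_mmu i) hf).
Qed.

Lemma weta_nat i u w (f : wmor u w) :
  wcmp (weta i w) f = wcmp (wT i f) (weta i u).
Proof.
case: f => [[f hf]|] //; apply: rep_eq; [by [] | by [] |].
by rewrite /= (slide_r (hom_meta i) hf) -(slide_l (hom_meta i) hf) /= hcomp_id_l.
Qed.

Lemma wlam_nat i j u w (f : wmor u w) :
  wcmp (wlam i j w) (wT j (wT i f)) = wcmp (wT i (wT j f)) (wlam i j u).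
Proof.
rewrite /wlam; case: f => [[f hf]|]; case: decP => // ij.
apply: rep_eq; [by [] | by [] |].
by rewrite /= -!hcomp_assoc (slide_l (hom_l ij) hf) (slide_r (hom_l ij) hf).
Qed.

(** Here and in the laws that follow, [whisker_sbw] strips off the common factor [sbw s w] and
    leaves the corresponding axiom for the letters involved. *)
Lemma wmu_mu i w : wcmp (wmu i w) (wmu i (i :: w)) = wcmp (wmu i w) (wT i (wmu i w)).
Proof.
apply: rep_eq; [by [] | by [] |]; rewrite /= -!hcomp_assoc -!whisker_sbw; try bnd.
by case: (monad_s i) => _ _ _ ->.
Qed.

Lemma wmu_eta_l i w : wcmp (wmu i w) (weta i (i :: w)) = wid (i :: w).
Proof.
apply: rep_eq; [by [] | by [] |]; rewrite /= -!hcomp_assoc -!whisker_sbw; try bnd.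
by case: (monad_s i) => _ _ _ _ [_ ->].
Qed.

Lemma wmu_eta_r i w : wcmp (wmu i w) (wT i (weta i w)) = wid (i :: w).
Proof.
apply: rep_eq; [by [] | by [] |]; rewrite /= -!hcomp_assoc -!whisker_sbw; try bnd.
by case: (monad_s i) => _ _ _ _ [-> _].
Qed.

Lemma wlam_mu_l i j w : i < j ->
  wcmp (wlam i j w) (wmu j (i :: w)) =
  wcmp (wT i (wmu j w)) (wcmp (wlam i j (j :: w)) (wT j (wlam i j w))).
Proof.
move=> ij; apply: rep_eq; [by rep | by rep |].
rewrite /= -!hcomp_assoc -!whisker_sbw; try bnd.
by case: (wdl_l ij) => _ ->.
Qed.

Lemma wlam_mu_r i j w : i < j ->
  wcmp (wlam i j w) (wT j (wmu i w)) =
  wcmp (wmu i (j :: w)) (wcmp (wT i (wlam i j w)) (wlam i j (i :: w))).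
Proof.
move=> ij; apply: rep_eq; [by rep | by rep |].
rewrite /= -!hcomp_assoc -!whisker_sbw; try bnd.
by case: (wdl_l ij) => _ _ ->.
Qed.

Lemma wlam_eta_l i j w : i < j ->
  wcmp (wlam i j w) (weta j (i :: w)) =
  wcmp (wmu i (j :: w)) (wcmp (wT i (wlam i j w))
    (wcmp (wT i (wT j (weta i w))) (wT i (weta j w)))).
Proof.
move=> ij; apply: rep_eq; [by rep | by rep |].
rewrite /= -!hcomp_assoc -!whisker_sbw; try bnd.
by case: (wdl_l ij) => _ _ _ ->.
Qed.

Lemma wlam_eta_r i j w : i < j ->
  wcmp (wlam i j w) (wT j (weta i w)) =
  wcmp (wT i (wmu j w)) (wcmp (wlam i j (j :: w))
    (wcmp (weta j (i :: j :: w)) (weta i (j :: w)))).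
Proof.
move=> ij; apply: rep_eq; [by rep | by rep |].
rewrite /= -!hcomp_assoc -!whisker_sbw; try bnd.
by case: (wdl_l ij) => _ _ _ _; rewrite -hcomp_assoc => ->.
Qed.

Lemma wyang_baxter i j k w : i < j -> j < k ->
  wcmp (wlam i j (k :: w)) (wcmp (wT j (wlam i k w)) (wlam j k (i :: w))) =
  wcmp (wT i (wlam j k w)) (wcmp (wlam i k (j :: w)) (wT k (wlam i j w))).
Proof.
move=> ij jk; have ik := ltn_trans ij jk; apply: rep_eq; [by rep | by rep |].
rewrite /= -!hcomp_assoc -!whisker_sbw; try bnd.
by rewrite yb_l.
Qed.

Definition words : wordcat n.+1 :=
  WordCat (fun _ _ => None) wcmpA wcmp1m wcmpm1 wT_id wT_cmp wmu_nat weta_nat wlam_nat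
    wmu_mu wmu_eta_l wmu_eta_r wlam_mu_l wlam_mu_r wlam_eta_l wlam_eta_r wyang_baxter.

(** * Cells of [K] underlying the actions and the idempotents *)

Fixpoint actc j w : Cell K A A :=
  if w is i :: w' then
    if i == j then hcomp (mmu (s j)) (sbw s w')
    else vcomp (hcomp (b i) (actc j w')) (hcomp (l i j) (sbw s w'))
  else id2 (idh A).

Lemma sbw_cat u w : sbw s (u ++ w) = hcomp (sbw s u) (sbw s w).
Proof. by elim: u => [|i u IH] /=; rewrite ?hcomp_id_l // IH hcomp_assoc. Qed.

Lemma sw_cat u w : sw s (u ++ w) = Defs.comp (sw s u) (sw s w).
Proof. by elim: u => [|i u IH] /=; rewrite ?comp_id_l // IH comp_assoc. Qed.

Lemma obj_cat u w : obj (u ++ w) = barcomp (obj u) (obj w).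
Proof. by rewrite sw_cat sbw_cat. Qed.

Lemma rep_act j w : acts j w -> rep (act words j w) (actc j w).
Proof.
elim: w => // i w IH /= /orP[/eqP-> | /andP[ij jw]].
  by rewrite act_hd eqxx; rep.
rewrite act_tl // -val_eqE /= (ltn_eqF ij); rep; exact: IH.
Qed.

Lemma hom_actc j w : acts j w -> hom (actc j w) (obj (j :: w)) (obj w).
Proof. by move/rep_act/rep_hom. Qed.

(** The letter that absorbs [j] lies in [u], so [w] is only whiskered. *)
Lemma actc_cat j u w : acts j u -> actc j (u ++ w) = hcomp (actc j u) (sbw s w).
Proof.
elim: u => // i u IH /= /orP[/eqP-> | /andP[ij ju]].
  by rewrite eqxx sbw_cat hcomp_assoc.
rewrite -val_eqE /= (ltn_eqF ij) IH // sbw_cat -!hcomp_assoc -whisker_sbw //.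
by autorewrite with bnd; rewrite (hom_src (hom_actc ju)).
Qed.

Definition lunitc j w := vcomp (actc j w) (hcomp (meta (s j)) (sbw s w)).

Lemma rep_lunit j w : acts j w -> rep (lunit words j w) (lunitc j w).
Proof. by move=> jw; rewrite lunitE; apply: rep_cmp; [exact: rep_act | rep]. Qed.

Fixpoint barc r w := if r is j :: r' then vcomp (barc r' w) (lunitc j w) else sbw s w.

Lemma rep_bar r w : all (acts^~ w) r -> rep (bar words r w) (barc r w).
Proof.
elim: r => [_|j r IH /= /andP[jw rw]]; first by rep.
by apply: rep_cmp; [exact: IH | exact: rep_lunit].
Qed.

Lemma lunitc_cat j u w : acts j u -> lunitc j (u ++ w) = hcomp (lunitc j u) (sbw s w).
Proof.
move=> ju; rewrite /lunitc actc_cat // sbw_cat -hcomp_assoc -whisker_sbw //.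
by rewrite (hom_src (hom_actc ju)); bnd.
Qed.

Lemma barc_cat r u w : all (acts^~ u) r -> barc r (u ++ w) = hcomp (barc r u) (sbw s w).
Proof.
elim: r => [_|j r IH /= /andP[ju ru]]; first exact: sbw_cat.
rewrite IH // lunitc_cat // -whisker_sbw //.
exact: hom_st (rep_hom (rep_lunit ju)) (rep_hom (rep_bar ru)).
Qed.

Lemma inc_acts w : inc w -> all (acts^~ w) w.
Proof. by move=> incw; apply/allP=> j; apply: acts_mem. Qed.

Lemma inc_rcons w k : inc (rcons w k) = all (fun i => i < k) w && inc w.
Proof. exact: pairwise_rcons. Qed.

Lemma inc_lt_mid p j w : inc (p ++ j :: w) -> all (fun i => i < j) p.
Proof.
rewrite -cat_rcons /inc pairwise_cat => /and3P[_ + _].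
by rewrite pairwise_rcons => /andP[].
Qed.

(** * Reordering composites and the idempotent of the product monad *)

Lemma hom_insc i w : hom (insc s l i w) (obj (i :: w)) (obj (ins i w)).
Proof.
elim: w => [|j w IH] /=; first exact: (hom_sbw [:: i]).
case: ifP => ji; last exact: (hom_sbw [:: i, j & w]).
exact: hom_vcomp (hom_hcomp (hom_b j) IH) (hom_wlam w ji).
Qed.

Lemma hom_sortc w : hom (sortc s l w) (obj w) (obj (isort w)).
Proof.
elim: w => [|i w IH] /=; first exact: (hom_sbw [::]).
exact: hom_vcomp (hom_insc i (isort w)) (hom_hcomp (hom_b i) IH).
Qed.

Lemma sort_inc w : inc w -> isort w = w /\ sortc s l w = sbw s w.
Proof.
elim: w => // i w IH /= /andP[iw /IH[ew es]].
rewrite ew es; case: w iw {IH ew es} => [|j w] /=.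
  by move=> _; split=> //; apply: (hom_bb_r (hom_sbw [:: i])).
case/andP=> ij _; rewrite ltnNge (ltnW ij) /=; split=> //.
exact: (hom_bb_r (hom_sbw [:: i, j & w])).
Qed.

(** The comparison in [ins] is strict, so the inserted [j] stops in front of the [j] already
    present, exactly where [past] stops. *)
Lemma rep_past j p w : all (fun i => i < j) p ->
  rep (past words j p (j :: w)) (insc s l j (p ++ j :: w)).
Proof.
elim: p => [_|i p IH /= /andP[ij /IH {}IH]] /=; first by rewrite ltnn; rep.
by rewrite ij; rep.
Qed.

Lemma rep_TT p u w (f : Mor words u w) c : rep f c -> rep (TT p f) (hcomp (sbw s p) c).
Proof.
move=> fc; elim: p => [|i p IH] /=; first by rewrite hcomp_id_l.
by rewrite hcomp_assoc; rep.
Qed.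

(** This is [TT_mu_past] for cells. The cell [c] is an identity in [arrowl_lunitc], and the
    multiplication of the letters to the right in [hmu_sortc]. *)
Lemma mu_insc p j u w c : all (fun i => i < j) p -> hom c (obj u) (obj w) ->
  vcomp (hcomp (sbw s p) (hcomp (mmu (s j)) c)) (insc s l j (p ++ j :: u)) =
  vcomp (actc j (p ++ j :: w)) (hcomp (b j) (hcomp (sbw s p) (hcomp (b j) c))).
Proof.
move=> pj hc; have rc : rep (mk hc) c by [].
have e := slide_l (hom_mmu j) hc; rewrite /= hcomp_assoc in e; rewrite -e.
have acj : acts j (p ++ j :: w).
  by elim: p pj {e} => [|i p IH] /=; rewrite ?eqxx // => /andP[-> /IH->]; rewrite orbT.
have := TT_mu_past (W := words) (mk hc) pj; apply: rep_inj.
  apply: rep_cmp (rep_past _ pj); apply: rep_TT; exact: rep_cmp (rep_mu _ _) _.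
apply: rep_cmp (rep_act acj) _; apply: rep_T; apply: rep_TT; exact: rep_T.
Qed.

(** Inserting [k] and multiplying it into the last letter is the action of [k]; precomposed with the
    unit of [s_k], this is a left multiplication by that unit. *)
Lemma arrowl_lunitc p k : inc (rcons p k) -> arrowl s l p k = lunitc k (rcons p k).
Proof.
move=> incpk; have [ei es] := sort_inc incpk.
have pk : all (fun i => i < k) p by move: incpk; rewrite inc_rcons => /andP[].
have ack : acts k (rcons p k) by rewrite acts_mem // mem_rcons mem_head.
rewrite /arrowl /lunitc /= ei es -cats1 in ack *.
rewrite (hom_bb_r (hom_insc k (p ++ [:: k]))).
have := mu_insc pk (hom_sbw [::]); rewrite /= !hcomp_id_r -{2}(hcomp_id_r (b k)).
rewrite -[hcomp (b k) (id2 _)]/(sbw s [:: k]) -sbw_cat (hom_bb_r (hom_actc ack)) => <-.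
have hi := hom_insc k (p ++ [:: k]); have he := hom_weta k (p ++ [:: k]).
rewrite vcomp_assoc ?(hom_st he hi) // (hom_tgt hi).
have -> : ins k (p ++ [:: k]) = p ++ [:: k; k].
  elim: p pk {incpk ei es ack hi he} => [_|i p IH /= /andP[-> /IH->]] //=.
  by rewrite ltnn.
by autorewrite with bnd; rewrite sw_cat /= comp_id_r.
Qed.

(** Induction on the last letter, following the recursive definition: [bar_rcons] splits off its
    [lunit], which is the arrow of [arrowl_lunitc]. One and two letters are separate clauses of the
    definition. *)
Lemma lbar_barc w : inc w -> lbar s l w = barc w w.
Proof.
elim/last_ind: w => [|p k IH] // incpk.
have := incpk; rewrite inc_rcons => /andP[pk incp].
have acp := inc_acts incp.
have acpk := inc_acts incpk.
have bpk : hcomp (barc p p) (b k) = barc p (rcons p k).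
  by rewrite -cats1 barc_cat //= hcomp_id_r.
have acp' : all (acts^~ (rcons p k)) p.
  by rewrite all_rcons in acpk; case/andP: acpk.
have ack : acts k (rcons p k) by rewrite all_rcons in acpk; case/andP: acpk.
have -> : barc (rcons p k) (rcons p k) = vcomp (lunitc k (rcons p k)) (barc p (rcons p k)).
  have := bar_rcons words p (rcons p k) k; apply: rep_inj; first exact: rep_bar.
  by apply: rep_cmp; [apply: rep_lunit | apply: rep_bar].
rewrite -arrowl_lunitc // -bpk /lbar rev_rcons.
case: p => [|i [|j p]] in pk IH incpk bpk incp acp acpk acp' ack *.
- rewrite arrowl_lunitc //= -[RHS]/(vcomp _ (hcomp (id2 _) _)) hcomp_id_l.
  have e : lunit words k [:: k] = idm _ by rewrite lunit_hd.
  rewrite (rep_inj (rep_lunit ack) (rep_id _) e) /= hcomp_id_r.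
  by rewrite (hom_bb_r (hom_b k)).
- move: pk; rewrite arrowl_lunitc //= andbT => ik.
  have -> : vcomp (lunitc k [:: i; k]) (hcomp (vcomp (hcomp (b i) (id2 (idh A)))
      (lunitc i [:: i])) (b k)) = lunitc k [:: i; k].
    have e : lunit words i [:: i] = idm _ by rewrite lunit_hd.
    rewrite (rep_inj (rep_lunit (j := i) (w := [:: i]) _) (rep_id _) e) /= ?eqxx //.
    rewrite hcomp_id_r (hom_bb_r (hom_b i)).
    have := hom_bb_r (rep_hom (rep_lunit ack)).
    by rewrite /= hcomp_id_r.
  (* [wdl_bar] is written with the unit of the smaller letter [i], and [lunitc] with that of [k];
     [lunit_mirror] identifies the two. *)
  have := esym (lunit_mirror words [::] ik); apply: rep_inj (rep_lunit ack).
  rewrite /wdl_bar -{1}(hcomp_id_r (b k)) -{1}(hcomp_id_r (l i k)).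
  rewrite -{1}(hcomp_id_r (meta (s i))) hcomp_assoc.
  by rep.
(* The prefix has at least two letters, so [lbr] of the whole word unfolds by its general clause. *)
- rewrite -IH // /lbar -[in RHS](revK [:: i, j & p]).
  have := size_rev [:: i, j & p].
  by case: (rev _) => [|x [|y r]] // _; rewrite revK.
Qed.

(** * The multiplication of the product monad *)

Fixpoint Actc r w : Cell K A A :=
  if r is j :: r' then vcomp (actc j w) (hcomp (b j) (Actc r' w)) else sbw s w.

Lemma rep_Act r w : all (acts^~ w) r -> rep (Act words r w) (Actc r w).
Proof.
elim: r => [_|j r IH /= /andP[jw rw]]; first by rep.
by apply: rep_cmp; [exact: rep_act | apply: rep_T; exact: IH].
Qed.

Definition twice w : seq 'I_n.+1 := flatten [seq [:: i; i] | i <- w].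

Lemma hom_hmu w : hom (hmu s w) (obj (twice w)) (obj w).
Proof.
elim: w => [|i w IH]; first exact: (hom_sbw [::]).
rewrite -[obj (twice (i :: w))]/(barcomp (t i) (barcomp (t i) (obj (twice w)))).
by rewrite -barcompA; exact: (hom_hcomp (hom_mmu i) IH).
Qed.

(** The sort inserts the first copy from its last letter on, so at an intermediate stage only a
    final segment [w] is doubled, and [p] holds the letters that are still single. *)
Lemma isort_twice p w : inc (p ++ w) -> isort (w ++ p ++ w) = p ++ twice w.
Proof.
elim: w p => [|j w IH] p; first by rewrite !cats0 => /sort_inc[].
move=> incI; have := IH (rcons p j); rewrite !cat_rcons => /(_ incI) /= ->.
have pj : all (fun i => i < j) p.
  exact: inc_lt_mid incI.
elim: p pj {incI IH} => [|i p IH /= /andP[-> /IH->]] //= _; by rewrite ltnn.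
Qed.

(** The induction is that of [isort_twice]: by [mu_insc], each insertion followed by its
    multiplication is one action. *)
Lemma hmu_sortc p w : inc (p ++ w) ->
  vcomp (hcomp (sbw s p) (hmu s w)) (sortc s l (w ++ p ++ w)) = Actc w (p ++ w).
Proof.
elim: w p => [|j w IH] p incI.
  rewrite /= hcomp_id_r; have [_ ->] := sort_inc incI.
  by rewrite cats0 (hom_bb_r (hom_sbw _)).
have pj : all (fun i => i < j) p.
  exact: inc_lt_mid incI.
have acj : acts j (p ++ j :: w) by rewrite acts_mem // mem_cat mem_head orbT.
have incI' : inc (rcons p j ++ w) by rewrite cat_rcons.
have hs := hom_sortc (w ++ p ++ j :: w).
have es : isort (w ++ p ++ j :: w) = p ++ j :: twice w.
  by have := isort_twice incI'; rewrite !cat_rcons.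
have hz : hom (hcomp (sbw s p) (hcomp (b j) (hmu s w)))
    (obj (p ++ j :: twice w)) (obj (p ++ j :: w)).
  by rewrite !obj_cat; exact: hom_hcomp (hom_sbw p) (hom_hcomp (hom_b j) (hom_hmu w)).
have hi := hom_insc j (p ++ j :: twice w).
have ei : ins j (p ++ j :: twice w) = p ++ [:: j, j & twice w].
  have := isort_twice incI; rewrite /= es; exact.
rewrite /= es; rewrite es in hs; rewrite ei in hi.
have hm := hom_hcomp (hom_sbw p) (hom_hmu (j :: w)).
rewrite -obj_cat in hm.
rewrite -vcomp_assoc ?(hom_st hi hm) ?(hom_st (hom_hcomp (hom_b j) hs) hi) //.
rewrite (mu_insc pj (hom_hmu w)).
rewrite vcomp_assoc; first last.
- exact: hom_st (hom_hcomp (hom_b j) hz) (hom_actc acj).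
- exact: hom_st (hom_hcomp (hom_b j) hs) (hom_hcomp (hom_b j) hz).
rewrite -(whisker_l (wf_t j)) ?(hom_st hs hz) //.
have := IH _ incI'; rewrite -cats1 sbw_cat /= hcomp_id_r -!catA /= => <-.
by rewrite hcomp_assoc.
Qed.

Lemma mmu_prodmon w : inc w -> w != [::] ->
  mmu (prodmon s l w) = vcomp (barc w w) (Actc w w).
Proof.
move=> incw; rewrite -lbar_barc //; have := hmu_sortc (p := [::]) incw.
by rewrite /= hcomp_id_l; case: w incw => //= i w _ ->.
Qed.

Lemma mt_prodmon w : mt (prodmon s l w) = Bar1 (sw s w) (lbar s l w).
Proof. by case: w. Qed.

Lemma rep_lbar w : inc w -> rep (bar words w w) (lbar s l w).
Proof. by move=> incw; rewrite lbar_barc //; apply/rep_bar/inc_acts. Qed.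

Lemma hom_lbar w : inc w -> hom (lbar s l w) (obj w) (obj w).
Proof. by move/rep_lbar/rep_hom. Qed.

Lemma lbar_idem w : inc w -> vcomp (lbar s l w) (lbar s l w) = lbar s l w.
Proof.
move=> incw; have := bar_idem words incw (inc_acts incw).
by apply: rep_inj; [apply: rep_cmp; exact: rep_lbar | exact: rep_lbar].
Qed.

Lemma wf_prod w : inc w -> wf1 (Bar1 (sw s w) (lbar s l w)).
Proof.
move=> incw; have h := hom_lbar incw.
by split; [exact: hom_src h | split; [exact: hom_tgt h | exact: lbar_idem]].
Qed.

Lemma hom_into_prod x w c : inc w -> hom c x (obj w) ->
  hom (vcomp (lbar s l w) c) x (Bar1 (sw s w) (lbar s l w)).
Proof.
move=> incw hc; have h := hom_vcomp (hom_lbar incw) hc; have [wx _ [e1 [e2 [_ e4]]]] := h.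
split=> //; first exact: wf_prod.
split=> //; split=> //; split=> //=.
rewrite -vcomp_assoc ?lbar_idem ?(hom_st hc (hom_lbar incw)) //.
exact: hom_st (hom_lbar incw) (hom_lbar incw).
Qed.

Lemma lbar_T_lbar i w : inc (i :: w) ->
  vcomp (lbar s l (i :: w)) (hcomp (b i) (lbar s l w)) = lbar s l (i :: w).
Proof.
move=> inciw; have incw : inc w by case/andP: inciw.
have := bar_T_bar words inciw.
by apply: rep_inj; [apply: rep_cmp; [|apply: rep_T]|]; apply: rep_lbar.
Qed.

Lemma lbar_rcons_lbar w k : inc (rcons w k) ->
  vcomp (lbar s l (rcons w k)) (hcomp (lbar s l w) (b k)) = lbar s l (rcons w k).
Proof.
move=> incwk; have /andP[_ incw] : all (fun i => i < k) w && inc w by rewrite -inc_rcons.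
have acwk := inc_acts incwk; have acw : all (acts^~ (rcons w k)) w.
  by move: acwk; rewrite all_rcons => /andP[].
have -> : hcomp (lbar s l w) (b k) = barc w (rcons w k).
  by rewrite -cats1 barc_cat ?inc_acts // lbar_barc //= hcomp_id_r.
have e : bar words (rcons w k) (rcons w k) =
    cmp (bar words (rcons w k) (rcons w k)) (bar words w (rcons w k)).
  by rewrite absorb_bar // => j jw; rewrite bar_lunit // mem_rcons inE jw orbT.
apply: rep_inj (esym e); last exact: rep_lbar.
by apply: rep_cmp; [exact: rep_lbar | exact: rep_bar].
Qed.

Lemma hom_heta w : hom (heta s w) (barid A) (obj w).
Proof.
elim: w => [|i w IH]; first exact: (hom_sbw [::]).
by rewrite -(barcomp1x (barid A)); exact: (hom_hcomp (hom_meta i) IH).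
Qed.

Lemma rep_etas r w : rep (etas words r w) (hcomp (heta s r) (sbw s w)).
Proof.
elim: r => [|j r IH] /=; first by rewrite hcomp_id_l; rep.
have h : hom (hcomp (heta s r) (sbw s w)) (obj w) (obj (r ++ w)) := rep_hom IH.
have := slide_l (hom_meta j) h; rewrite /= hcomp_id_l => e.
by rewrite hcomp_assoc -e; apply: rep_cmp (rep_eta _ _) IH.
Qed.

(* [phi_first] is the composite of the edges of the cube that adjoin the letters of [w]
   to [i] one after the other; [phi_rest] is the edge that adjoins [i] to [w]. *)
Definition phi_first i w := vcomp (lbar s l (i :: w)) (hcomp (b i) (heta s w)).
Definition phi_rest i w := vcomp (lbar s l (i :: w)) (hcomp (meta (s i)) (sbw s w)).

Lemma hom_phi_first i w : inc (i :: w) ->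
  hom (phi_first i w) (t i) (Bar1 (sw s (i :: w)) (lbar s l (i :: w))).
Proof.
move=> inciw; apply: hom_into_prod => //.
by have := hom_hcomp (hom_b i) (hom_heta w); rewrite barcompx1.
Qed.

Lemma hom_phi_rest i w : inc (i :: w) ->
  hom (phi_rest i w) (obj w) (Bar1 (sw s (i :: w)) (lbar s l (i :: w))).
Proof. by move=> inciw; apply: hom_into_prod (hom_weta i w). Qed.

Lemma mmu_phi_first_rest i w : inc (i :: w) ->
  vcomp (mmu (prodmon s l (i :: w))) (hcomp (phi_first i w) (phi_rest i w))
  = lbar s l (i :: w).
Proof.
move=> inciw; set I := i :: w in inciw *.
have acI := inc_acts inciw; have acII : all (acts^~ (I ++ I)) I.
  by apply/allP=> j jI; apply/acts_cat/acts_mem.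
have h1 := hom_vcomp (hom_lbar inciw)
  (hom_hcomp (hom_b i) (hom_heta w) : hom _ _ (obj (i :: w))).
have h2 := hom_vcomp (hom_lbar inciw) (hom_weta i w).
rewrite mmu_prodmon // /phi_first /phi_rest -/I barcompx1 in h1 *.
rewrite -(slide_l h1 h2) [bb _]/= whisker_sbw; last first.
  by rewrite (hom_src (hom_lbar inciw)); autorewrite with bnd; rewrite (hom_tgt (hom_heta w)).
(* The idempotent of [s_I] whiskered by a second [s_I] becomes [barc I (I ++ I)], as its letters act
   inside the first copy. *)
rewrite {1}lbar_barc // -barc_cat // hcomp_assoc.
have := mul_first_rest words inciw; apply: rep_inj; last exact: rep_lbar.
apply: rep_cmp; first by apply: rep_cmp; [exact: rep_bar | exact: rep_Act].
apply: rep_cmp.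
  by apply: rep_cmp; [exact: rep_bar | apply: rep_T; exact: rep_etas].
by apply: rep_T; apply: rep_cmp (rep_eta _ _); exact: rep_lbar.
Qed.

Lemma mmu_phi_second_first i j : i < j ->
  vcomp (mmu (prodmon s l [:: i; j])) (hcomp (phi_rest i [:: j]) (phi_first i [:: j]))
  = l i j.
Proof.
have b2 w : bb (obj w) = sbw s w by [].
move=> ij; set I := [:: i; j]; have incI : inc I by rewrite /I /= ij.
have acI := inc_acts incI; have acII : all (acts^~ (I ++ I)) I.
  by apply/allP=> k kI; apply/acts_cat/acts_mem.
have h1 := hom_vcomp (hom_lbar incI)
  (hom_hcomp (hom_b i) (hom_heta [:: j]) : hom _ _ (obj [:: i; j])).
have h2 := hom_vcomp (hom_lbar incI) (hom_weta i [:: j]).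
rewrite mmu_prodmon // /phi_first /phi_rest -/I barcompx1 in h1 *.
rewrite -(slide_l h2 h1) b2 b2 [sbw s [:: j]]hcomp_id_r whisker_sbw; last first.
  by rewrite (hom_src (hom_lbar incI)) /I /=; bnd.
rewrite {1}lbar_barc // -barc_cat // hcomp_assoc -[RHS]hcomp_id_r.
have := mul_second_first words ij; apply: rep_inj; last exact: rep_lam.
apply: rep_cmp; first by apply: rep_cmp; [exact: rep_bar | exact: rep_Act].
apply: rep_cmp.
  by apply: rep_cmp; [exact: rep_bar | exact: rep_eta].
by apply: rep_T; apply: rep_cmp (rep_T _ (rep_eta _ _)); exact: rep_lbar.
Qed.

(** The idempotent of the prefix slides past the unit of [s_k] and is absorbed by that of the longer
    word, so edges compose without intermediate idempotents. *)
Lemma phi_last_first i w k : inc (i :: rcons w k) ->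
  vcomp (vcomp (lbar s l (i :: rcons w k)) (hcomp (sbw s (i :: w)) (meta (s k))))
    (phi_first i w) = phi_first i (rcons w k).
Proof.
rewrite -!rcons_cons => incI.
have /andP[_ incJ] : all (fun i => i < k) (i :: w) && inc (i :: w) by rewrite -inc_rcons.
have hJ := hom_lbar incJ; have hI := hom_lbar incI.
have hf := hom_hcomp (hom_b i) (hom_heta w); rewrite barcompx1 in hf.
have hk := hom_hcomp (hom_sbw (i :: w)) (hom_meta k); rewrite barcompx1 in hk.
have ek : obj (rcons (i :: w) k) = barcomp (obj (i :: w)) (t k).
  by rewrite -cats1 obj_cat; congr barcomp; exact: (barcompx1 (t k)).
have hIJ := hom_hcomp hJ (hom_b k); rewrite -ek in hk hIJ.
rewrite /phi_first -[barcomp (t i) _]/(obj (i :: w)) in hf *.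
rewrite vcomp_assoc; [|exact: hom_st (hom_vcomp hJ hf) hk|exact: hom_st hk hI].
rewrite -(vcomp_assoc (x := hcomp _ (meta (s k)))); first last.
- exact: hom_st hJ hk.
- exact: hom_st hf hJ.
have e1 := slide_l hJ (hom_meta k); rewrite /= in e1.
have e2 := slide_r hJ (hom_meta k); rewrite /= hcomp_id_r in e2.
have -> : vcomp (hcomp (sbw s (i :: w)) (meta (s k))) (lbar s l (i :: w)) =
    vcomp (hcomp (lbar s l (i :: w)) (b k)) (hcomp (sbw s (i :: w)) (meta (s k))).
  by rewrite [LHS]e2 [RHS]e1.
rewrite vcomp_assoc; [|exact: hom_st hf hk|exact: hom_st hk hIJ].
rewrite -(vcomp_assoc (x := lbar s l (rcons _ k))); first last.
- exact: hom_st hIJ hI.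
- exact: hom_st (hom_vcomp hk hf) hIJ.
rewrite lbar_rcons_lbar //; congr vcomp.
have := slide_r hf (hom_meta k); rewrite /= hcomp_id_r => ->.
rewrite hcomp_assoc; congr hcomp.
by elim: (w) => [|j v IH] /=; rewrite ?hcomp_id_l ?hcomp_id_r // hcomp_assoc IH.
Qed.

Lemma hom_phi_last w k : inc (rcons w k) ->
  hom (vcomp (lbar s l (rcons w k)) (hcomp (sbw s w) (meta (s k)))) (obj w)
    (Bar1 (sw s (rcons w k)) (lbar s l (rcons w k))).
Proof.
move=> incwk; apply: hom_into_prod => //; rewrite -cats1 obj_cat.
have e : obj [:: k] = t k := barcompx1 (t k).
by rewrite e -{1}(barcompx1 (obj w)); apply: (hom_hcomp (hom_sbw w) (hom_meta k)).
Qed.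

Lemma hom_mmu_prod w : inc w -> w != [::] ->
  hom (mmu (prodmon s l w)) (obj (w ++ w)) (obj w).
Proof.
move=> incw w0; rewrite mmu_prodmon //; have acw := inc_acts incw.
exact: hom_vcomp (rep_hom (rep_bar acw)) (rep_hom (rep_Act acw)).
Qed.

Lemma prod1 i : Bar1 (sw s [:: i]) (lbar s l [:: i]) = t i.
Proof. by rewrite /lbar /= comp_id_r; case: (t i). Qed.

Lemma prodmon1 i : prodmon s l [:: i] = s i.
Proof.
rewrite /prodmon prod1 /= ltnn !hcomp_id_r.
have -> : lbar s l [:: i] = b i by [].
rewrite !(hom_bb_r (hom_b i)) (hom_bb_l (hom_meta i)) (hom_bb_l (hom_meta i)).
rewrite (hom_bb_r (hom_hcomp (hom_b i) (hom_b i))) (hom_bb_r (hom_mmu i)).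
by rewrite (hom_bb_l (hom_mmu i)); case: (s i).
Qed.

End Words.

(** * Fullness *)

Lemma inc_enum m (p : {set 'I_m}) : inc (enum p).
Proof.
rewrite /inc {1}/enum_mem; apply: pairwise_filter.
rewrite -enumT.
have := pairwise_map (fun i : 'I_m => val i) ltn (enum 'I_m); rewrite val_enum_ord => <-.
by rewrite -(sorted_pairwise ltn_trans) iota_ltn_sorted.
Qed.

(** Increasing words thus name the vertices of the cube, which allows induction on words. *)
Lemma enum_inc m (w : seq 'I_m) : inc w -> enum [set x in w] = w.
Proof.
move=> incw; have tr : transitive (fun i j : 'I_m => i < j) by move=> ? ? ?; apply: ltn_trans.
apply: (irr_sorted_eq tr) => [i||| i]; first exact: ltnn.
- by rewrite (sorted_pairwise tr); apply: inc_enum.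
- by rewrite (sorted_pairwise tr).
- by rewrite mem_enum inE.
Qed.

(* [atoms] lists the sources and targets of the atomic cells. *)
Ltac st atoms :=
  by rewrite ?(src_vcomp, tgt_vcomp, src_hcomp, tgt_hcomp, atoms, comp_assoc) //=
     ?(src_hcomp, tgt_hcomp, atoms, comp_assoc, comp_id_r).

(** * A monad morphism evaluated on a product of two 2-cells *)

Section Restrict.
Variables (K : TwoCat) (A A' : Ob K) (m : Mon K A) (m' : Mon K A')
  (v : bar1 K A A') (psi : Cell K A A').
Hypothesis (psi_mnd1 : is_mnd1 m m' v psi).
Variables (x1 x2 : bar1 K A A) (y1 y2 : bar1 K A' A').
Variables (f1 f2 : Cell K A A) (f1' f2' : Cell K A' A') (xi1 xi2 : Cell K A A').
Hypotheses (hf1 : hom f1 x1 (mt m)) (hf2 : hom f2 x2 (mt m)).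
Hypotheses (hf1' : hom f1' y1 (mt m')) (hf2' : hom f2' y2 (mt m')).
Hypotheses (src_mu : src (mmu m) = Defs.comp (b1 (mt m)) (b1 (mt m)))
  (src_mu' : src (mmu m') = Defs.comp (b1 (mt m')) (b1 (mt m')))
  (tgt_mu' : tgt (mmu m') = b1 (mt m')).
Hypotheses (src_xi1 : src xi1 = Defs.comp (b1 y1) (b1 v))
  (tgt_xi1 : tgt xi1 = Defs.comp (b1 v) (b1 x1))
  (src_xi2 : src xi2 = Defs.comp (b1 y2) (b1 v))
  (tgt_xi2 : tgt xi2 = Defs.comp (b1 v) (b1 x2)).
Hypotheses (psi1 : vcomp psi (hcomp f1' (bb v)) = vcomp (hcomp (bb v) f1) xi1)
  (psi2 : vcomp psi (hcomp f2' (bb v)) = vcomp (hcomp (bb v) f2) xi2).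

(** As [psi] respects multiplication, its value on a product is found by applying it to the second
    factor, then to the first; [psi2] and [psi1] express these through [xi2] and [xi1]. *)
Lemma mnd1_restrict :
  vcomp psi (hcomp (vcomp (mmu m') (hcomp f1' f2')) (bb v)) =
  vcomp (hcomp (bb v) (vcomp (mmu m) (hcomp f1 f2)))
    (vcomp (hcomp xi1 (bb x2)) (hcomp (bb y1) xi2)).
Proof.
have [wv [src_psi [tgt_psi [_ _]]] psi_mu _] := psi_mnd1.
have [[wx1 wt _] [wx2 _ _]] := (hf1, hf2).
have [[wy1 wt' _] [wy2 _ _]] := (hf1', hf2').
have S := (src_bb wv, tgt_bb wv, src_bb wx1, tgt_bb wx1, src_bb wx2, tgt_bb wx2,
  src_bb wy1, tgt_bb wy1, src_bb wt, tgt_bb wt, src_bb wt', tgt_bb wt').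
have S1 := (S, hom_src hf1, hom_tgt hf1, hom_src hf2, hom_tgt hf2,
  hom_src hf1', hom_tgt hf1', hom_src hf2', hom_tgt hf2').
have S2 := (S1, src_mu, src_mu', tgt_mu', src_xi1, tgt_xi1, src_xi2, tgt_xi2, src_psi, tgt_psi).
rewrite (whisker_r wv); last st S2.
rewrite -vcomp_assoc; [|st S2|st S2].
rewrite psi_mu hcomp_assoc.
rewrite vcomp_assoc; [|st S2|st S2].
rewrite vcomp_assoc; [|st S2|st S2].
rewrite -(Defs.interchange (y := f1')); [|st S2|st S2].
(* The idempotent of [y1] is split off [f1'], so that the interchange leaves [xi2] whiskered by it.
   The first factor is treated likewise with [x2]. *)
rewrite psi2 (hom_bb_l hf1') -{1}(hom_bb_r hf1').
rewrite Defs.interchange; [|st S2|st S2].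
rewrite -(vcomp_assoc (x := hcomp psi _)); [|st S2|st S2].
rewrite -[hcomp f1' (hcomp _ _)]hcomp_assoc.
rewrite -(Defs.interchange (x := psi)); [|st S2|st S2].
rewrite psi1 (hom_bb_l hf2) -{1}(hom_bb_r hf2).
rewrite Defs.interchange; [|st S2|st S2].
rewrite hcomp_assoc (whisker_l wv); last st S2.
rewrite !vcomp_assoc //; st S2.
Qed.

End Restrict.

Lemma bar1_eq_sides K (A B : Ob K) (x y : bar1 K A B) :
  barcomp (barid B) x = barcomp y (barid A) -> x = y.
Proof. by rewrite barcomp1x barcompx1. Qed.

Lemma cube_mon_inc K n (X : WObj K n) w : inc w ->
  cube_mon X [set x in w] = prodmon (wm X) (wl X) w.
Proof. by move=> incw; rewrite /cube_mon enum_inc. Qed.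

Lemma set_in_cons m i (w : seq 'I_m) : [set x in i :: w] = i |: [set x in w].
Proof. by apply/setP=> j; rewrite !inE. Qed.

Lemma set_in_rcons m k (w : seq 'I_m) : [set x in rcons w k] = k |: [set x in w].
Proof. by apply/setP=> j; rewrite !inE mem_rcons. Qed.

Lemma cube_phi_rest K n (X : WObj K n) i w : inc (i :: w) ->
  cube_phi X [set x in w] i = phi_rest (wm X) (wl X) i w.
Proof.
move=> inciw; have /andP[/allP iw incw] := inciw.
rewrite /cube_phi -set_in_cons !enum_inc // /phi_rest.
rewrite (eq_in_filter (a2 := pred0)) ?filter_pred0 /= ?hcomp_id_l; last first.
  by move=> j /iw ij; rewrite ltnNge (ltnW ij).
rewrite (eq_in_filter (a2 := predT)) ?filter_predT // => j /iw ij; exact: ij.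
Qed.

Lemma cube_phi_last K n (X : WObj K n) k w : inc (rcons w k) ->
  cube_phi X [set x in w] k =
  vcomp (lbar (wm X) (wl X) (rcons w k)) (hcomp (sbw (wm X) w) (meta (wm X k))).
Proof.
move=> incwk; have := incwk; rewrite inc_rcons => /andP[/allP wk incw].
rewrite /cube_phi -set_in_rcons !enum_inc //.
rewrite (eq_in_filter (a2 := predT)) ?filter_predT; last by move=> j /wk.
rewrite (eq_in_filter (a2 := pred0)) ?filter_pred0 /= ?hcomp_id_r // => j /wk jk.
by rewrite ltnNge (ltnW jk).
Qed.

(** * Components of a 1-cell between image cubes *)

Section CubeMorphism.
Variables (K : TwoCat) (n : nat) (X Y : WObj K n).
Hypotheses (wfX : wobj_wf X) (wfY : wobj_wf Y).
Variable U : {ffun {set 'I_n.+1} -> bar1 K (wA X) (wA Y) * Cell K (wA X) (wA Y)}.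
Hypothesis wfU : cube1_wf X Y U.
Implicit Types (i j k : 'I_n.+1) (w : seq 'I_n.+1).

Local Notation v := (U set0).1.
Local Notation psi w := (U [set x in w]).2.
Local Notation sX i := (wm X i).
Local Notation sY i := (wm Y i).

(** The edges of both cubes lie over identity 1-cells, so the square at [i] equates the 1-cell parts
    at [p] and at [p] without [i]. *)
Lemma cube_base p : (U p).1 = v.
Proof.
have [m] := ubnP #|p|; elim: m p => // m IH p ltm.
have [->|[i ip]] := set_0Vmem p; first by [].
have [_ /(_ (p :\ i) i)] := wfU; rewrite setD11 setD1K // => /(_ isT) [e1 e2 _].
have e : barcomp (barid _) (U p).1 = barcomp (U (p :\ i)).1 (barid _) by congr Bar1.
rewrite (bar1_eq_sides e); apply: IH.
by rewrite (cardsD1 i p) ip in ltm.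
Qed.

Lemma wf_v : wf1 v.
Proof. by have [/(_ set0) [] ] := wfU. Qed.

Lemma cube_mnd1 w : inc w ->
  is_mnd1 (prodmon (wm X) (wl X) w) (prodmon (wm Y) (wl Y) w) v (psi w).
Proof.
move=> incw; have [/(_ [set x in w])] := wfU.
by rewrite !cube_mon_inc // cube_base.
Qed.

Lemma hom_psi w : inc w ->
  hom (psi w) (barcomp (Bar1 (sw (wm Y) w) (lbar (wm Y) (wl Y) w)) v)
    (barcomp v (Bar1 (sw (wm X) w) (lbar (wm X) (wl X) w))).
Proof.
move=> incw; have [_ + _ _] := cube_mnd1 incw; rewrite !mt_prodmon.
have [[mX lX yX] [mY lY yY]] := (wfX, wfY).
by split=> //; apply: wf_barcomp; first [exact: wf_v | exact: wf_prod].
Qed.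

Lemma cube_edge_eq i w : i \notin w ->
  vcomp (U (i |: [set x in w])).2 (hcomp (cube_phi Y [set x in w] i) (bb v)) =
  vcomp (hcomp (bb v) (cube_phi X [set x in w] i)) (psi w).
Proof.
move=> iw; have [_ /(_ [set x in w] i)] := wfU; rewrite inE => /(_ iw) [_ _].
by rewrite /= !cube_base hcomp_id_l hcomp_id_r.
Qed.

Lemma psi_rest i w : inc (i :: w) ->
  vcomp (psi (i :: w)) (hcomp (phi_rest (wm Y) (wl Y) i w) (bb v)) =
  vcomp (hcomp (bb v) (phi_rest (wm X) (wl X) i w)) (psi w).
Proof.
move=> inciw; rewrite -!cube_phi_rest // set_in_cons cube_edge_eq //.
by have /andP[/allP iw _] := inciw; apply/negP=> /iw; rewrite ltnn.
Qed.

(** The compatibility squares are pasted along a path of edges, adjoining the largest letter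
    last. *)
Lemma psi_first i w : inc (i :: w) ->
  vcomp (psi (i :: w)) (hcomp (phi_first (wm Y) (wl Y) i w) (bb v)) =
  vcomp (hcomp (bb v) (phi_first (wm X) (wl X) i w)) (psi [:: i]).
Proof.
have [[mX lX yX] [mY lY yY]] := (wfX, wfY).
elim/last_ind: w => [_|w k IH incI].
  have h := hom_psi (w := [:: i]) isT.
  have e (Z : WObj K n) : (forall j, is_monad (wm Z j)) ->
      phi_first (wm Z) (wl Z) i [::] = lbar (wm Z) (wl Z) [:: i].
    move=> mZ; rewrite /phi_first /= hcomp_id_r; exact: bb_idem (wf_t mZ i).
  by rewrite !e // [LHS](hom_bb_r h) [RHS](hom_bb_l h).
have incJ : inc (i :: w).
  by move: incI; rewrite -rcons_cons inc_rcons => /andP[].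
rewrite -!phi_last_first //; rewrite -!rcons_cons in incI *.
have kJ : k \notin i :: w.
  by apply/negP=> kJ; move: incI; rewrite inc_rcons => /andP[/allP/(_ _ kJ)]; rewrite ltnn.
have := cube_edge_eq kJ; rewrite -set_in_rcons !cube_phi_last //.
have EX := hom_phi_last mX lX yX incI; have EY := hom_phi_last mY lY yY incI.
have pX := hom_phi_first mX lX yX incJ; have pY := hom_phi_first mY lY yY incJ.
have hI := hom_psi incI; have hJ := hom_psi incJ; have h1 := hom_psi (w := [:: i]) isT.
set eY := vcomp (lbar _ _ _) _ in EY *; set eX := vcomp (lbar _ _ _) _ in EX *.
move=> edge; rewrite (whisker_r wf_v); last by rewrite (hom_tgt pY) (hom_src EY).
rewrite -vcomp_assoc; first last.
- by rewrite tgt_hcomp (hom_tgt EY) (tgt_bb wf_v) (hom_src hI).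
- by rewrite tgt_hcomp src_hcomp (hom_tgt pY) (hom_src EY) (tgt_bb wf_v) (src_bb wf_v).
rewrite edge vcomp_assoc; first last.
- by rewrite src_hcomp (hom_src EX) (src_bb wf_v) (hom_tgt hJ).
- by rewrite tgt_hcomp (hom_tgt pY) (tgt_bb wf_v) (hom_src hJ).
rewrite IH // -vcomp_assoc; first last.
- by rewrite tgt_hcomp src_hcomp (hom_tgt pX) (hom_src EX) (tgt_bb wf_v) (src_bb wf_v).
- by rewrite src_hcomp (hom_src pX) (src_bb wf_v) (hom_tgt h1) /= comp_id_r.
by rewrite -(whisker_l wf_v) // (hom_tgt pX) (hom_src EX).
Qed.

Lemma hom_xi i : hom (psi [:: i]) (barcomp (mt (sY i)) v) (barcomp v (mt (sX i))).
Proof. by have := hom_psi (w := [:: i]) isT; rewrite !prod1. Qed.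

Local Notation xcU := (xc (wm X) (wm Y) v (fun i => psi [:: i])).

Lemma xc_cons i j w :
  xcU [:: i, j & w] =
  vcomp (hcomp (psi [:: i]) (sbw (wm X) (j :: w)))
    (hcomp (bb (mt (sY i))) (xcU (j :: w))).
Proof. by []. Qed.

Lemma st_xc w : src (xcU w) = Defs.comp (sw (wm Y) w) (b1 v) /\
  tgt (xcU w) = Defs.comp (b1 v) (sw (wm X) w).
Proof.
have [[mX lX yX] [mY lY yY]] := (wfX, wfY).
elim: w => [|i [|j w] [IHs IHt]].
- by rewrite /= (src_bb wf_v) (tgt_bb wf_v) comp_id_l comp_id_r.
- by rewrite [xcU _]/= (hom_src (hom_xi i)) (hom_tgt (hom_xi i)) /= !comp_id_r.
have st : tgt (hcomp (bb (mt (sY i))) (xcU (j :: w))) =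
    src (hcomp (psi [:: i]) (sbw (wm X) (j :: w))).
  rewrite tgt_hcomp src_hcomp IHt (tgt_b mY) (hom_src (hom_xi i)).
  by rewrite (hom_src (hom_sbw mX (j :: w))) comp_assoc.
rewrite xc_cons src_vcomp // tgt_vcomp // src_hcomp tgt_hcomp IHs (src_b mY).
rewrite (hom_tgt (hom_xi i)) (hom_tgt (hom_sbw mX (j :: w))) /=.
by rewrite !comp_assoc.
Qed.

(** For [I = i :: L], the idempotent of [s_I] is the product of [phi_first] and [phi_rest].
    Evaluating [psi I] on it by [mnd1_restrict] leaves [psi [:: i]] and [psi L], and induction
    applies to the latter. *)
Lemma psi_xc w : inc w -> w != [::] ->
  psi w = vcomp (hcomp (bb v) (lbar (wm X) (wl X) w)) (xcU w).
Proof.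
have [[mX lX yX] [mY lY yY]] := (wfX, wfY).
elim: w => // i [|j w] IH incI _; first exact: (esym (hom_bb_l (hom_xi i))).
set L := j :: w in IH incI *.
have incL : inc L by case/andP: incI.
have [[hI hL] hi] := (hom_psi incI, hom_psi incL, hom_xi i).
have [sxc txc] := st_xc L.
have muX := hom_mmu_prod mX lX yX incI isT; have muY := hom_mmu_prod mY lY yY incI isT.
have bX := hom_lbar mX lX yX incL; have bXI := hom_lbar mX lX yX incI.
have e : vcomp (psi (i :: L)) (hcomp (lbar (wm Y) (wl Y) (i :: L)) (bb v)) =
    vcomp (hcomp (bb v) (lbar (wm X) (wl X) (i :: L)))
      (vcomp (hcomp (psi [:: i]) (sbw (wm X) L)) (hcomp (bb (mt (sY i))) (psi L))).
  rewrite -(mmu_phi_first_rest mX lX yX incI) -(mmu_phi_first_rest mY lY yY incI).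
  (* The source of [phi_rest] is [s_L] with the composite idempotent of its letters, not that of the
     product monad; this yields the [sbw] that occurs in [xc]. *)
  apply: (mnd1_restrict (cube_mnd1 incI) (x2 := Bar1 (sw (wm X) L) (sbw (wm X) L))
    (y2 := Bar1 (sw (wm Y) L) (sbw (wm Y) L))).
  - by rewrite mt_prodmon; apply: hom_phi_first.
  - by rewrite mt_prodmon; apply: hom_phi_rest.
  - by rewrite mt_prodmon; apply: hom_phi_first.
  - by rewrite mt_prodmon; apply: hom_phi_rest.
  - by rewrite mt_prodmon (hom_src muX); exact: sw_cat.
  - by rewrite mt_prodmon (hom_src muY); exact: sw_cat.
  - by rewrite mt_prodmon (hom_tgt muY).
  - exact: hom_src hi.
  - exact: hom_tgt hi.
  - exact: hom_src hL.
  - exact: hom_tgt hL.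
  - exact: psi_first.
  - exact: psi_rest.
rewrite -[LHS](hom_bb_r hI) [LHS]e IH // xc_cons.
rewrite (whisker_l (wf_t mY i)); last by rewrite txc src_hcomp (src_bb wf_v) (hom_src bX).
rewrite -(vcomp_assoc (x := hcomp (psi [:: i]) _)); first last.
- rewrite tgt_hcomp src_hcomp tgt_hcomp (tgt_b mY) (tgt_bb wf_v) (hom_tgt bX) (hom_src hi).
  by rewrite (hom_src (hom_sbw mX L)) /= comp_assoc.
- by rewrite tgt_hcomp !src_hcomp txc (tgt_b mY) (src_b mY) (src_bb wf_v) (hom_src bX).
(* The idempotent of [s_L] in the formula for [psi L] moves to the left of [psi [:: i]], where that
   of [s_I] absorbs it by [lbar_T_lbar]. *)
have -> : vcomp (hcomp (psi [:: i]) (sbw (wm X) L))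
    (hcomp (bb (mt (sY i))) (hcomp (bb v) (lbar (wm X) (wl X) L))) =
  vcomp (hcomp (bb v) (hcomp (bb (mt (sX i))) (lbar (wm X) (wl X) L)))
    (hcomp (psi [:: i]) (sbw (wm X) L)).
  rewrite -(hcomp_assoc (bb (mt (sY i)))) -(hcomp_assoc (bb v)).
  by rewrite [LHS](slide_l hi bX) [RHS](slide_r hi bX).
have hT := hom_hcomp (hom_bb wf_v) (hom_hcomp (hom_b mX i) bX).
have hbT := hom_hcomp (hom_b mX i) bX.
rewrite (vcomp_assoc (y := hcomp (psi _) _)); first last.
- by rewrite tgt_hcomp (hom_tgt hi) (hom_tgt (hom_sbw mX L)) (hom_src hT) /= comp_assoc.
- rewrite tgt_hcomp src_hcomp txc (tgt_b mY) (hom_src hi) (hom_src (hom_sbw mX L)).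
  by rewrite /= comp_assoc.
rewrite -vcomp_assoc; first last.
- by rewrite (hom_tgt hT) src_hcomp (src_bb wf_v) (hom_src bXI).
- rewrite tgt_vcomp tgt_hcomp ?(hom_tgt hi) ?(hom_tgt (hom_sbw mX L)) ?(hom_src hT)
    /= ?comp_assoc //.
  rewrite src_hcomp txc (tgt_b mY) (hom_src hi) (hom_src (hom_sbw mX L)).
  by rewrite /= comp_assoc.
rewrite -(whisker_l wf_v); last by rewrite (hom_tgt hbT) (hom_src bXI).
by rewrite lbar_T_lbar.
Qed.

(** Both sides evaluate [psi [:: i; j]] on the distributive law of [Y]: the left one by
    multiplicativity and [mmu_phi_second_first], the right one by the formula of [psi_xc]. *)
Lemma cube_wdl1 i j : i < j ->
  is_wdl1 (sX j) (sX i) (sY j) (sY i) (wl X i j) (wl Y i j) v (psi [:: j]) (psi [:: i]).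
Proof.
move=> ij; have [[mX lX yX] [mY lY yY]] := (wfX, wfY).
have incI : inc [:: i; j] by rewrite /= ij.
have muX := hom_mmu_prod mX lX yX incI isT; have muY := hom_mmu_prod mY lY yY incI isT.
have [hi hj] := (hom_xi i, hom_xi j).
have [hI hlY hlX] := And3 (hom_psi incI) (hom_l mY lY ij) (hom_lbar mX lX yX incI).
have := psi_xc incI isT; rewrite /= -!/(sbw _ _) hcomp_id_r => epsi.
rewrite /is_wdl1.
have -> : wdl_bar (sX j) (sX i) (wl X i j) = lbar (wm X) (wl X) [:: i; j] by [].
have e : vcomp (psi [:: i; j]) (hcomp (wl Y i j) (bb v)) =
  vcomp (hcomp (bb v) (wl X i j))
    (vcomp (hcomp (psi [:: j]) (bb (mt (sX i)))) (hcomp (bb (mt (sY j))) (psi [:: i]))).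
  rewrite -{1}(mmu_phi_second_first mX lX yX ij) -{1}(mmu_phi_second_first mY lY yY ij).
  rewrite -[bb (mt (sY j))]hcomp_id_r.
  apply: (mnd1_restrict (cube_mnd1 incI) (y1 := Bar1 (sw (wm Y) [:: j]) (sbw (wm Y) [:: j]))
    (x1 := Bar1 (sw (wm X) [:: j]) (sbw (wm X) [:: j])) (y2 := mt (sY i))).
  - by rewrite mt_prodmon; apply: hom_phi_rest.
  - by rewrite mt_prodmon; apply: hom_phi_first.
  - by rewrite mt_prodmon; apply: hom_phi_rest.
  - by rewrite mt_prodmon; apply: hom_phi_first.
  - by rewrite mt_prodmon (hom_src muX); exact: sw_cat.
  - by rewrite mt_prodmon (hom_src muY); exact: sw_cat.
  - by rewrite mt_prodmon (hom_tgt muY).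
  - by rewrite (hom_src hj) /= comp_id_r.
  - by rewrite (hom_tgt hj) /= comp_id_r.
  - exact: hom_src hi.
  - exact: hom_tgt hi.
  - exact: psi_rest.
  - exact: psi_first.
have S := (src_b mX, tgt_b mX, src_b mY, tgt_b mY, src_bb wf_v, tgt_bb wf_v,
  hom_src hi, hom_tgt hi, hom_src hj, hom_tgt hj).
have S1 := (S, hom_src hlY, hom_tgt hlY, hom_src hlX, hom_tgt hlX).
by rewrite -[LHS]e epsi !vcomp_assoc //; st S1.
Qed.

(** Both monads at the empty subset are trivial, so the unit law determines the component there. *)
Lemma cube_empty : (U set0).2 = bb v.
Proof.
have [/(_ set0)] := wfU; rewrite /cube_mon enum_set0 /= => -[_ [_ [_ [_ e]]] _].
by rewrite /= hcomp_id_l hcomp_id_r in e *; rewrite e.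
Qed.

Lemma cube_is_image : exists F : WHom X Y, whom_wf F /\ E1 F = U.
Proof.
have [[mX lX yX] [mY lY yY]] := (wfX, wfY).
pose xi := [ffun i : 'I_n.+1 => psi [:: i]].
have xcE u : xc (wm X) (wm Y) v xi u = xcU u.
  elim: u => // j [|k u] IH; first by rewrite /= ffunE.
  by rewrite xc_cons -IH -[psi [:: j]](ffunE (fun i => psi [:: i])).
exists (MkWHom v xi); split.
  split=> [i | i j ij] /=; rewrite !ffunE; last exact: cube_wdl1.
  by have := cube_mnd1 (w := [:: i]) isT; rewrite !prodmon1.
apply/ffunP=> p; rewrite ffunE /= [RHS]surjective_pairing cube_base; congr pair.
rewrite /xiP /=; have := inc_enum p; have := set_enum p.
case: (enum p) => [<- _ | i w <- incw]; first by rewrite cube_empty.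
by rewrite (psi_xc incw) // -xcE.
Qed.

End CubeMorphism.

Theorem theorem4p6 (K : TwoCat) (n : nat) (X Y : WObj K n) :
  wobj_wf X -> wobj_wf Y ->
  [/\ (* injective on 1-cells *)
      forall F G : WHom X Y, whom_wf F -> whom_wf G -> E1 F = E1 G -> F = G,
      (* injective on 2-cells *)
      forall (F G : WHom X Y) (w w' : Cell K (wA X) (wA Y)),
        w2_wf F G w -> w2_wf F G w' -> E2 X Y w = E2 X Y w' -> w = w',
      (* full on 1-cells *)
      forall U, cube1_wf X Y U -> exists F : WHom X Y, whom_wf F /\ E1 F = U &
      (* full on 2-cells *)
      forall F G : WHom X Y, whom_wf F -> whom_wf G ->
        forall Om, cube2_wf (E1 F) (E1 G) Om ->
          exists w, w2_wf F G w /\ E2 X Y w = Om].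
Proof.
move=> wfX wfY.
(* At a singleton the idempotent in [xiP] is that of [s_i], already absorbed by [hxi F i]. *)
have xiP1 (F : WHom X Y) i : whom_wf F -> xiP F [set i] = hxi F i.
  by case=> /(_ i) [_ [_ [_ [e _]]] _ _] _; rewrite /xiP enum_set1.
split.
- move=> F G wF wG e; have eP p : E1 F p = E1 G p by rewrite e.
  have := eP set0; rewrite !ffunE => -[ev _].
  case: F G wF wG ev eP {e} => v xi [v' xi'] wF wG /= ev eP.
  rewrite -ev in wG eP *; congr MkWHom; apply/ffunP=> i.
  have := congr1 snd (eP [set i]); rewrite !ffunE /=.
  by rewrite (xiP1 (MkWHom v xi)) // (xiP1 (MkWHom v xi')).
- by move=> F G w w' _ _ /ffunP/(_ set0); rewrite !ffunE.
- by move=> U; apply: cube_is_image.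
move=> F G wF wG Om [Om_mnd2 Om_edge].
(* The edges lie over identity 1-cells, so the edge condition makes [Om] constant, by induction on
   the cardinality of [p]. *)
have OmE p : Om p = Om set0.
  have [m] := ubnP #|p|; elim: m p => // m IH p ltm.
  have [->|[i ip]] := set_0Vmem p; first by [].
  have := Om_edge (p :\ i) i; rewrite setD11 setD1K // => /(_ isT).
  rewrite hcomp_id_l hcomp_id_r => ->; apply: IH.
  by rewrite (cardsD1 i p) ip in ltm.
exists (Om set0); split=> [i|]; last by apply/ffunP=> p; rewrite ffunE OmE.
have [[mX lX yX] [mY lY yY]] := (wfX, wfY).
have := Om_mnd2 [set i]; rewrite !ffunE /= !xiP1 // OmE.
by rewrite /cube_mon enum_set1 !prodmon1.
Qed.
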